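(* Suppose that $X$ is a general hypersurface of degree $d$ in $\mathbb{P}^n$ and $\Sigma$ is a cone of lines in $X$ over a curve $Y \subset \mathbb{P}^{n-1}$. If the linear span of $Y$ has dimension $> (n-2)/2$, then a general line parametrized by $Y$ is free.
   Context: We work over $\mathbb{C}$. ''General hypersurface of degree $d$'' means: for all $[X]$ in a suitable nonempty (dense) Zariski open subset of the projective space parametrizing hypersurfaces of degree $d$ in $\mathbb{P}^n$. Here $\Sigma\subset X$ is a cone with some vertex $p\in X$; the lines of $\mathbb{P}^n$ through $p$ are parametrized by a $\mathbb{P}^{n-1}$ (for instance a hyperplane not containing $p$), and $Y\subset\mathbb{P}^{n-1}$ is a curve all of whose points correspond to lines through $p$ contained in $X$, $\Sigma$ being the union of these lines. A line $l$ in $X$ is free if its normal bundle $N_{l/X}$ in $X$ is globally generated. *)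

(* Defs.v *)
From HB Require Import structures.
From mathcomp Require Import all_boot all_order all_algebra.
From mathcomp Require Import boolp classical_sets reals.
From mathcomp Require Import complex.
From mathcomp Require Import mpoly.

Set Implicit Arguments.
Unset Strict Implicit.
Unset Printing Implicit Defensive.

Import Order.TTheory GRing.Theory Num.Theory.

Local Open Scope classical_set_scope.
Local Open Scope ring_scope.

(* P(V), the space of lines of V, is handled through homogeneous coordinates: *)
(* a point is given by a nonzero vector of V, and a subset of P(V) by the set *)
(* of all its nonzero representatives.  Thus P^n is P('rV_n.+1), and degree d *)
(* hypersurfaces in P^n are parametrized by P(dhomog n.+1 K d).               *)
Section Zariski.
Variables (K : fieldType) (V : vectType K).
Implicit Types (Z U Y : set V) (W : {vspace V}).

Definition proj_space : set V := [set v : V | v != 0].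

(* The Zariski topology does not depend on the choice of the basis of V.      *)
Definition proj_zeros (I : set {mpoly K[\dim {:V}]}) : set V :=
  [set v : V | v != 0 /\
    forall G, I G -> G.@[fun i => coord (vbasis {:V}) i v] = 0].

Definition zclosed Z : Prop :=
  exists2 I : set {mpoly K[\dim {:V}]},
    (forall G, I G -> exists e : nat, G \is e.-homog) & Z = proj_zeros I.

Definition zopen U : Prop := exists2 Z, zclosed Z & U = proj_space `\` Z.

Definition zirreducible Z : Prop :=
  [/\ zclosed Z, Z !=set0 &
      forall A B, zclosed A -> zclosed B ->
        Z `<=` A `|` B -> Z `<=` A \/ Z `<=` B].

Definition irreducible_chain Z (k : nat) (C : nat -> set V) : Prop :=
  (forall i, (i <= k)%N -> zirreducible (C i) /\ C i `<=` Z) /\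
  (forall i, (i < k)%N -> C i `<` C i.+1).

Definition krull_dim Z (k : nat) : Prop :=
  (exists C, irreducible_chain Z k C) /\
  (forall l C, irreducible_chain Z l C -> (l <= k)%N).

Definition proj_curve Y : Prop := zirreducible Y /\ krull_dim Y 1.

(* Only used for Z irreducible, where a nonempty open subset is dense. *)
Definition for_general Z (P : V -> Prop) : Prop :=
  exists U, [/\ zopen U, (Z `&` U) !=set0 & forall v, Z v -> U v -> P v].

Definition is_linear_span Y W : Prop :=
  (forall y, Y y -> y \in W) /\
  (forall W', (forall y, Y y -> y \in W') -> (W <= W')%VS).

(* The projective dimension of P(W) is \dim W - 1. *)
Definition linear_span_dim Y (m : nat) : Prop :=
  exists2 W, is_linear_span Y W & \dim W = m.+1.

End Zariski.

Arguments proj_space {K} V.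

Section Lines.
Variables (K : fieldType) (n : nat).
Implicit Types (F : {mpoly K[n.+1]}) (L : {vspace 'rV[K]_n.+1}).
Implicit Types (p q v : 'rV[K]_n.+1).

Definition hypersurface F : set 'rV[K]_n.+1 :=
  [set q : 'rV[K]_n.+1 | q != 0 /\ F.@[q 0] = 0].

(* When the rows of [col_mx p B] form a basis of K^(n+1), y |-> y *m B        *)
(* identifies P^(n-1) with a hyperplane not containing p, and y |-> join_line *)
(* p B y identifies P^(n-1) with the lines through p.                         *)
Definition join_line p (B : 'M[K]_(n, n.+1)) (y : 'rV[K]_n) :
    {vspace 'rV[K]_n.+1} :=
  (<[p]> + <[y *m B]>)%VS.

Definition cone_over p (B : 'M[K]_(n, n.+1)) (Y : set 'rV[K]_n) :
    set 'rV[K]_n.+1 :=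
  [set q : 'rV[K]_n.+1 | q != 0 /\ exists2 y, Y y & q \in join_line p B y].

Definition differential F q v : K := \sum_i (F^`M(i)).@[q 0] * v 0 i.

(* The hypersurface is smooth at the points of P(L). *)
Definition smooth_along F L : Prop :=
  forall q, q \in L -> q != 0 -> exists v, differential F q v != 0.

(* Let l = P(L) be a line in X = V(F), with X smooth along l.  By the Euler   *)
(* sequence, for q in L \ 0,                                                  *)
(*   T_[q] l = Hom(<q>, L / <q>),   T_[q] X = Hom(<q>, ker dF_q / <q>),       *)
(* so the fibre of N_{l/X} = (T_X)|_l / T_l at [q] is Hom(<q>, ker dF_q / L). *)
(* A section s of N_{l/X} is represented by a function sending q in L \ 0 to  *)
(* a representative in ker dF_q, modulo L, of the image of q under s([q]).    *)
(* It is regular when it is, locally on l, a quotient of homogeneous          *)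
(* polynomials whose degrees differ by 1.                                     *)
Definition normal_section F L (s : 'rV[K]_n.+1 -> 'rV[K]_n.+1) : Prop :=
  [/\ forall q, q \in L -> q != 0 -> differential F q (s q) = 0,
      forall a q, a != 0 -> q \in L -> q != 0 ->
        s (a *: q) - a *: s q \in L
    & forall q0, q0 \in L -> q0 != 0 ->
        exists (e : nat) (G : {mpoly K[n.+1]}) (P : 'I_n.+1 -> {mpoly K[n.+1]}),
          [/\ G \is e.-homog, forall i, P i \is e.+1.-homog,
              G.@[q0 0] != 0
            & forall q, q \in L -> q != 0 -> G.@[q 0] != 0 ->
                s q - (G.@[q 0])^-1 *: (\row_i (P i).@[q 0]) \in L]].

(* Global sections generate every fibre of the vector bundle N_{l/X}. *)
Definition normal_globally_generated F L : Prop :=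
  forall q v, q \in L -> q != 0 -> differential F q v = 0 ->
    exists2 s, normal_section F L s & s q - v \in L.

Definition free_line F L : Prop :=
  [/\ \dim L = 2, forall q, q \in L -> q != 0 -> hypersurface F q,
      smooth_along F L & normal_globally_generated F L].

End Lines.

(* Main.v *)
(* Restricted to a line [L] of [X = V(F)], the partial derivatives of [F] span
   the forms of degree [d - 1] exactly when [H^1(N_{L/X}(-1)) = 0], i.e. when
   [L] is free, and this is an open condition on [L].  So if the general line of
   the cone is not free, every line of the cone carries a nonzero functional on
   forms of degree [d - 1] killing all partial derivatives of [F].

   Pick [c = m + 1] independent points of [Y], giving lines through [p] and [z_i]
   with functionals [l_i].  For fixed [p], [z_i] and [l_i] the
   equations "[F] vanishes on the lines" and "[l_i] kills the partials of [F] on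
   the i-th line" are independent linear conditions on [F], as soon as each [l_i]
   involves a coefficient beyond the 2-jet at [p].  Since each [z_i] moves on [Y],
   a dimension count with [n < 2 c] shows that such [F] lie in a proper closed
   subset.  Otherwise the cone over [Y] lies, modulo [p], in the kernel of the
   Hessian of [F] at [p], whose corank is then at least [m + 1], which is
   excluded for general [F] by another dimension count.

   Dimension counts are done by elimination: a polynomial map (with a common
   denominator) from [K^a] to [K^b] with [a < b] satisfies a polynomial relation.
   That a point moves on [Y] is expressed by saying that some of its coordinates
   can avoid the zeros of any given nonzero polynomial [Q]. *)

Require Import Defs.
From HB Require Import structures.
From mathcomp Require Import all_boot all_order all_algebra.
From mathcomp Require Import boolp classical_sets reals.
From mathcomp Require Import complex.
From mathcomp Require Import mpoly.
From mathcomp Require Import zify ring.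

Set Implicit Arguments.
Unset Strict Implicit.
Unset Printing Implicit Defensive.

Import Order.TTheory GRing.Theory Num.Theory.
Local Open Scope classical_set_scope.
Local Open Scope ring_scope.

(** * Polynomial maps and elimination *)

Section PolynomialMaps.
Variable K : numFieldType.

(** The exceptional forms must be fixed before [Y], while [Y] depends on [F] and belongs to no given
    family. So only finitely many lines of the cone enter the incidence variety, and its fibres are
    asked to be large instead: over a bad [F] the data [(z_i, l_i)] can be chosen with four
    coordinates per line off any given hypersurface. Two come from moving [z_i] on the plane spanned
    by its line, one from moving the line along [Y], one from rescaling [l_i]. Each line brings
    [n + 1 + d] parameters and [d + n - 1] conditions, so prescribing four coordinates leaves a gain
    of 2, against the [n] parameters left for [p] once [F] vanishes there. This is where [n < 2 c],
    that is, the bound [(n - 2) / 2] on the span, comes from; the same inequality implies the one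
    for the Hessian. Smoothness at [p] links the two cases: by Euler's identity it turns a
    functional that sees only the 2-jet into a kernel vector of the Hessian. *)

Lemma poly_nonroot (p : {poly K}) : p != 0 -> exists c : nat, p.[c%:R] != 0.
Proof.
move=> p0; apply: contrapT => /forallNP h.
pose rs := [seq (i%:R : K) | i <- iota 0 (size p)].
have : (size rs < size p)%N.
  apply: max_poly_roots => //.
    by apply/allP => _ /mapP[i _ ->]; apply/eqP; move/negP: (h i) => /negPn/eqP.
  by rewrite map_inj_uniq ?iota_uniq // => i j /eqP; rewrite eqr_nat => /eqP.
by rewrite size_map size_iota ltnn.
Qed.

Lemma poly_nonroot_neq0 (p : {poly K}) : p != 0 ->
  exists2 c, c != 0 & p.[c] != 0.
Proof.
move=> p0; have pX : p * 'X != 0 by rewrite mulf_neq0 // polyX_eq0.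
have [c] := poly_nonroot pX.
by rewrite hornerMX mulf_eq0 negb_or => /andP[? ?]; exists c%:R.
Qed.

Lemma poly_eq_nonzero (p q : {poly K}) :
  (forall c : K, c != 0 -> p.[c] = q.[c]) -> p = q.
Proof.
move=> h; apply/eqP; rewrite -subr_eq0; apply: contraT => pq.
have [c c0] := poly_nonroot_neq0 pq.
by rewrite hornerD hornerN h // subrr eqxx.
Qed.

Lemma digits_inj (D n : nat) (a b : 'I_n -> nat) :
  (forall i, a i < D)%N -> (forall i, b i < D)%N ->
  (\sum_i a i * D ^ i = \sum_i b i * D ^ i)%N -> a =1 b.
Proof.
elim: n a b => [|n IH] a b ha hb; first by move=> _ [].
have E (c : 'I_n.+1 -> nat) : (\sum_i c i * D ^ i
    = c ord0 + (\sum_(i < n) c (lift ord0 i) * D ^ i) * D)%N.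
  rewrite big_ord_recl /= muln1 big_distrl /=; congr addn.
  by apply: eq_bigr => i _; rewrite -mulnA -expnSr.
rewrite !E => h.
have D0 : (0 < D)%N by case: D ha {hb E IH h} => // /(_ ord0).
have h0 : a ord0 = b ord0.
  move/(congr1 (modn^~ D)): h.
  by rewrite !(addnC _ (_ * D)%N) !modnMDl !modn_small.
move: h; rewrite h0 => /addnI /eqP; rewrite eqn_pmul2r // => /eqP h i.
case: (unliftP ord0 i) => [j ->|-> //].
exact: (IH (fun i => a (lift ord0 i)) (fun i => b (lift ord0 i))).
Qed.

(* Kronecker substitution: ['X_i := x ^ (D ^ i)] with [D] above the degree is
   injective on monomials. *)
Lemma meval_neq0 (n : nat) (P : {mpoly K[n]}) :
  P != 0 -> exists v : 'I_n -> K, P.@[v] != 0.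
Proof.
move=> P0; pose D := msize P.
pose q := \sum_(m <- msupp P) P@_m *: 'X^(\sum_i m i * D ^ i)%N : {poly K}.
have hd m i : m \in msupp P -> (m i < D)%N.
  move=> /msize_mdeg_lt; apply: leq_ltn_trans.
  by rewrite mdegE (bigD1 i) //= leq_addr.
have q0 : q != 0.
  apply/eqP => /(congr1 (fun q : {poly K} => q`_(\sum_i mlead P i * D ^ i)%N)).
  rewrite coef0 coef_sum (bigD1_seq (mlead P)) ?mlead_supp ?msupp_uniq //=.
  rewrite coefZ coefXn eqxx mulr1 big_seq_cond big1 ?addr0; last first.
    move=> m /andP[mP mne]; rewrite coefZ coefXn; case: eqP => [e|];
      last by rewrite mulr0.
    by case/eqP: mne; apply/mnmP => i; rewrite -[LHS](@digits_inj D _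
      (mlead P) m) // => j; apply: hd => //; exact: mlead_supp.
  by move/eqP; rewrite mleadc_eq0 (negbTE P0).
have [c hc] := poly_nonroot q0.
exists (fun i => c%:R ^+ (D ^ i)); move: hc; apply: contraNN.
rewrite mevalE /q horner_sum => /eqP h; apply/eqP; rewrite -[RHS]h;
  apply: eq_bigr => m _.
rewrite !hornerE; congr (_ * _); rewrite expr_sum.
by apply: eq_bigr => i _; rewrite mulnC exprM.
Qed.

Lemma msizeM_leS (n : nat) (P Q : {mpoly K[n]}) (a b : nat) :
  (msize P <= a.+1)%N -> (msize Q <= b.+1)%N -> (msize (P * Q) <= (a + b).+1)%N.
Proof.
have [->|P0] := eqVneq P 0; first by rewrite mul0r msize0.
have [->|Q0] := eqVneq Q 0; first by rewrite mulr0 msize0.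
move=> hP hQ; rewrite msizeM // -subn1 leq_subLR add1n -addnS -addSn.
exact: leq_add.
Qed.

Lemma msize_prod_le (n : nat) (I : Type) (r : seq I) (P : I -> {mpoly K[n]})
    (e : I -> nat) :
  (forall i, (msize (P i) <= (e i).+1)%N) ->
  (msize (\prod_(i <- r) P i) <= (\sum_(i <- r) e i).+1)%N.
Proof.
move=> h; elim: r => [|i r IH]; first by rewrite !big_nil msize1.
by rewrite !big_cons; apply: msizeM_leS.
Qed.

Lemma msize_exp_le (n : nat) (P : {mpoly K[n]}) (e k : nat) :
  (msize P <= e.+1)%N -> (msize (P ^+ k) <= (e * k).+1)%N.
Proof.
move=> h; elim: k => [|k IH]; first by rewrite expr0 msize1 muln0.
by rewrite exprS mulnS; apply: msizeM_leS.
Qed.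

(* Monomials of degree at most [D] in each variable number [D.+1 ^ n]; after
   clearing denominators they map to polynomials in fewer variables whose
   degree is linear in [D]. *)
Lemma mpoly_dependence (m n : nat) (P : 'I_n -> {mpoly K[m]})
    (Q : {mpoly K[m]}) : (m < n)%N ->
  exists2 G : {mpoly K[n]}, G != 0 &
    forall v, Q.@[v] != 0 -> G.@[fun i => (P i).@[v] / Q.@[v]] = 0.
Proof.
move=> mn.
pose E := maxn (msize Q) (\max_i msize (P i)).
(* There are at least [D.+1 ^ m.+1] exponents since [m < n], while the images have degree at most
   [n E D] and lie in a space of dimension at most [((n E + 1) (D + 1)) ^ m = D (D + 1) ^ m], which
   is smaller. *)
pose D := ((n * E).+1 ^ m)%N.
pose M := (n * (E * D))%N.
pose R (e : {ffun 'I_n -> 'I_D.+1}) := \prod_i (P i ^+ e i * Q ^+ (D - e i)).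
have hP i : (msize (P i) <= E.+1)%N.
  by rewrite leqW // leq_max (leq_bigmax i) orbT.
have hQ : (msize Q <= E.+1)%N by rewrite leqW // leq_max leqnn.
have hR e : (msize (R e) <= M.+1)%N.
  rewrite (_ : M = \sum_(i < n) E * D)%N; last by rewrite sum_nat_const card_ord.
  apply: msize_prod_le => i.
  have /ltnSE he := ltn_ord (e i); rewrite -[in X in (_ <= X)%N](subnKC he) mulnDr.
  by apply: msizeM_leS; exact: msize_exp_le.
pose nm := #|{: {ffun 'I_n -> 'I_D.+1}}|.
pose mm := #|{: {ffun 'I_m -> 'I_M.+1}}|.
pose mon (e : {ffun 'I_m -> 'I_M.+1}) := [multinom (e i : nat) | i < m].
pose A : 'M[K]_(nm, mm) := \matrix_(i, j) (R (enum_val i))@_(mon (enum_val j)).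
have lt : (mm < nm)%N.
  rewrite /mm /nm !card_ffun !card_ord.
  have le : (M.+1 <= (n * E).+1 * D.+1)%N by rewrite /M; nia.
  apply: leq_ltn_trans (_ : (((n * E).+1 * D.+1) ^ m < _)%N).
    by case: (m) => // m'; rewrite leq_exp2r.
  rewrite expnMn -/D; apply: (@leq_trans (D.+1 ^ m.+1)%N).
    by rewrite expnS ltn_pmul2r // expn_gt0.
  by rewrite leq_pexp2l.
have kA : kermx A != 0.
  rewrite kermx_eq0 /row_free; apply: contraTneq (rank_leq_col A) => ->.
  by rewrite -ltnNge.
have [i ri] : exists i, row i (kermx A) != 0.
  apply: contrapT => /forallNP h; case/eqP: kA; apply/row_matrixP => i.
  by rewrite row0; apply/eqP/negPn/negP/h.
pose c := row i (kermx A).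
have cA : c *m A = 0 by rewrite /c -row_mul mulmx_ker row0.
pose mon' (e : {ffun 'I_n -> 'I_D.+1}) := [multinom (e i : nat) | i < n].
have cR : \sum_e c 0 (enum_rank e) *: R e = 0.
  apply/mpolyP => k; rewrite mcoeff0 linear_sum /=.
  have [hk|hk] := boolP [forall i, k i < M.+1]%N; last first.
    rewrite big1 // => e _; rewrite mcoeffZ.
    rewrite (memN_msupp_eq0 (p := R e)) ?mulr0 //.
    apply: msize_mdeg_ge; apply: leq_trans (hR e) _.
    move: hk; rewrite negb_forall => /existsP[j]; rewrite -leqNgt => hj.
    by apply: leq_trans hj _; rewrite mdegE (bigD1 j) //= leq_addr.
  pose e0 : {ffun 'I_m -> 'I_M.+1} := [ffun i => inord (k i)].
  move/matrixP: cA => /(_ 0 (enum_rank e0)); rewrite !mxE => h.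
  rewrite -[RHS]h [RHS](reindex (@enum_rank {ffun 'I_n -> 'I_D.+1})) /=; last first.
    by apply: onW_bij; exists enum_val; [exact: enum_rankK|exact: enum_valK].
  apply: eq_bigr => e _; rewrite mcoeffZ !mxE !enum_rankK; congr (_ * mcoeff _ _).
  apply/mnmP => j; rewrite mnmE ffunE inordK //.
  by move/forallP: hk.
exists (\sum_e c 0 (enum_rank e) *: 'X_[mon' e]).
  apply/eqP => G0; case/eqP: ri; apply/rowP => j; rewrite [RHS]mxE -/c.
  move/mpolyP: G0 => /(_ (mon' (enum_val j))); rewrite mcoeff0 linear_sum /=.
  rewrite (bigD1 (enum_val j)) //= mcoeffZ mcoeffX eqxx mulr1 enum_valK.
  rewrite big1 ?addr0 // => e ne; rewrite mcoeffZ mcoeffX.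
  case: eqP => [/mnmP h|]; rewrite ?mulr0 //.
  case/eqP: ne; apply/ffunP => s; apply/val_inj.
  by have := h s; rewrite !mnmE.
move=> v Qv; apply: (mulfI (expf_neq0 (n * D) Qv)); rewrite mulr0.
rewrite -(meval0 v) -cR !linear_sum mulr_sumr; apply: eq_bigr => e _ /=.
rewrite !mevalZ mevalX mulrCA; congr (_ * _).
rewrite /R rmorph_prod /= mulnC exprM -[X in _ ^+ X](card_ord n) -prodr_const.
rewrite -big_split /=; apply: eq_bigr => j _.
rewrite mnmE rmorphM !rmorphXn /= expr_div_n.
have /ltnSE he := ltn_ord (e j).
rewrite -[in Q.@[v] ^+ D](subnK he) exprD mulrC -!mulrA [X in _ * X]mulrC.
rewrite mulrA [X in _ = X]mulrC.
by rewrite -!mulrA mulrCA mulfV ?mulr1 // expf_neq0.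
Qed.

Lemma homog_meval_scale n e (G : {mpoly K[n]}) (c : K) (v : 'I_n -> K) :
  G \is e.-homog -> G.@[fun i => c * v i] = c ^+ e * G.@[v].
Proof.
move=> /dhomogP h; rewrite !mevalE mulr_sumr; apply: eq_big_seq => m mG.
rewrite mulrCA; congr (_ * _); under eq_bigr do rewrite exprMn.
rewrite big_split /=; congr (_ * _).
by rewrite -expr_sum -mdegE (h _ mG).
Qed.

End PolynomialMaps.

(** * Polynomial functions indexed by finite types *)

Section PolynomialFunctions.
Variable K : numFieldType.

(** An arbitrary finite index type lets the parameters of an incidence variety be described by sums
    and products of types; the enumeration of [J] stays hidden here. *)
Definition polyfun (J : finType) (f : (J -> K) -> K) : Prop :=
  exists P : {mpoly K[#|J|]}, forall u, f u = P.@[fun i => u (enum_val i)].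

Section Closure.
Variable J : finType.
Implicit Types f g : (J -> K) -> K.

Lemma polyfun_ext f g : f =1 g -> polyfun f -> polyfun g.
Proof. by move=> e [P h]; exists P => u; rewrite -e. Qed.

Lemma polyfun_cst c : polyfun (fun _ : J -> K => c).
Proof. by exists c%:MP => u; rewrite mevalC. Qed.

Lemma polyfun_coord j : polyfun (fun u : J -> K => u j).
Proof. by exists 'X_(enum_rank j) => u; rewrite mevalXU enum_rankK. Qed.

Lemma polyfunD f g : polyfun f -> polyfun g -> polyfun (fun u => f u + g u).
Proof. by move=> [P hP] [Q hQ]; exists (P + Q) => u; rewrite mevalD hP hQ. Qed.

Lemma polyfunM f g : polyfun f -> polyfun g -> polyfun (fun u => f u * g u).
Proof. by move=> [P hP] [Q hQ]; exists (P * Q) => u; rewrite mevalM hP hQ. Qed.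

Lemma polyfunN f : polyfun f -> polyfun (fun u => - f u).
Proof. by move=> [P hP]; exists (- P) => u; rewrite mevalN hP. Qed.

Lemma polyfun_sum (A : Type) (r : seq A) (p : pred A) (f : A -> (J -> K) -> K) :
  (forall a, polyfun (f a)) -> polyfun (fun u => \sum_(a <- r | p a) f a u).
Proof.
move=> h; elim: r => [|a r IH].
  by apply: (polyfun_ext _ (polyfun_cst 0)) => u; rewrite big_nil.
case pa: (p a); last first.
  by apply: (polyfun_ext _ IH) => u; rewrite big_cons pa.
by apply: (polyfun_ext _ (polyfunD (h a) IH)) => u; rewrite big_cons pa.
Qed.

Lemma polyfun_prod (A : Type) (r : seq A) (p : pred A) (f : A -> (J -> K) -> K) :
  (forall a, polyfun (f a)) -> polyfun (fun u => \prod_(a <- r | p a) f a u).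
Proof.
move=> h; elim: r => [|a r IH].
  by apply: (polyfun_ext _ (polyfun_cst 1)) => u; rewrite big_nil.
case pa: (p a); last first.
  by apply: (polyfun_ext _ IH) => u; rewrite big_cons pa.
by apply: (polyfun_ext _ (polyfunM (h a) IH)) => u; rewrite big_cons pa.
Qed.

Lemma polyfunX f k : polyfun f -> polyfun (fun u => f u ^+ k).
Proof.
move=> h; apply: (polyfun_ext _ (polyfun_prod (index_enum 'I_k) predT
  (fun _ => h))) => u.
by rewrite prodr_const card_ord.
Qed.

Lemma polyfun_det n (A : (J -> K) -> 'M[K]_n) :
  (forall i j, polyfun (fun u => A u i j)) -> polyfun (fun u => \det (A u)).
Proof.
move=> h; apply: polyfun_sum => s; apply: polyfunM; first exact: polyfun_cst.
by apply: polyfun_prod => i; exact: h.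
Qed.

Lemma polyfun_adj n (A : (J -> K) -> 'M[K]_n) :
  (forall i j, polyfun (fun u => A u i j)) ->
  forall i j, polyfun (fun u => (\adj (A u)) i j).
Proof.
move=> h i j.
apply: (@polyfun_ext (fun u => cofactor (A u) j i)) => [u|]; first by rewrite mxE.
apply: polyfunM; first exact: polyfun_cst.
apply: polyfun_det => a b; apply: (polyfun_ext _ (h (lift j a) (lift i b))) => u.
by rewrite !mxE.
Qed.

Lemma polyfun_meval n (P : {mpoly K[n]}) (f : 'I_n -> (J -> K) -> K) :
  (forall i, polyfun (f i)) -> polyfun (fun u => P.@[fun i => f i u]).
Proof.
move=> h; apply: polyfun_sum => m; apply: polyfunM; first exact: polyfun_cst.
by apply: polyfun_prod => i; apply: polyfunX.
Qed.

(** Two nonempty open subsets of an affine space meet: polynomials form a domain, and a nonzero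
    polynomial has a nonzero value because [K] is infinite. *)
Lemma polyfun_mul_neq0 f g : polyfun f -> polyfun g ->
  (exists u, f u != 0) -> (exists u, g u != 0) -> exists u, f u * g u != 0.
Proof.
move=> [P hP] [Q hQ] [u fu] [v gv].
have P0 : P != 0 by apply: contraNneq fu => P0; rewrite hP P0 meval0.
have Q0 : Q != 0 by apply: contraNneq gv => Q0; rewrite hQ Q0 meval0.
have [w hw] := meval_neq0 (mulf_neq0 P0 Q0).
exists (fun j => w (enum_rank j)); rewrite hP hQ -mevalM; apply: contra_neq hw.
by move=> <-; apply: meval_eq => i; rewrite enum_valK.
Qed.

Lemma polyfun_prod_neq0 (A : finType) (f : A -> (J -> K) -> K) :
  (forall a, polyfun (f a)) -> (forall a, exists u, f a u != 0) ->
  exists u, forall a, f a u != 0.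
Proof.
move=> h n0; suff [u hu] : exists u, \prod_(a <- index_enum A) f a u != 0.
  by exists u => a; move/prodf_neq0: hu; apply.
elim: (index_enum A) => [|a r [u hu]].
  by exists (fun=> 0); rewrite big_nil oner_eq0.
have [v hv] := polyfun_mul_neq0 (h a) (@polyfun_prod _ r predT _ h) (n0 a)
  (ex_intro _ u hu).
by exists v; rewrite big_cons.
Qed.

Lemma polyfun_horner f (q : J -> {poly K}) : polyfun f ->
  exists p : {poly K}, forall c, f (fun j => (q j).[c]) = p.[c].
Proof.
move=> [P hP]; exists (\sum_(m <- msupp P) P@_m *:
  \prod_i q (enum_val i) ^+ m i) => c.
rewrite hP mevalE horner_sum; apply: eq_bigr => m _.
rewrite hornerZ horner_prod; congr (_ * _); apply: eq_bigr => i _.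
by rewrite horner_exp.
Qed.

End Closure.

Lemma polyfun_comp (J X : finType) (f : (X -> K) -> K)
    (g : X -> (J -> K) -> K) :
  polyfun f -> (forall x, polyfun (g x)) -> polyfun (fun u => f (fun x => g x u)).
Proof.
move=> [P hP] h.
by apply: (polyfun_ext _ (@polyfun_meval _ _ P (fun i => g (enum_val i)) _)) => //.
Qed.

Lemma polyfun_dependence (J X : finType) (f : X -> (J -> K) -> K)
    (d : (J -> K) -> K) :
  (forall x, polyfun (f x)) -> polyfun d -> (#|J| < #|X|)%N ->
  exists G : (X -> K) -> K, [/\ polyfun G, exists x, G x != 0 &
    forall u, d u != 0 -> G (fun x => f x u / d u) = 0].
Proof.
move=> /choice[P hP] [Q hQ] lt.
have [G G0 hG] := mpoly_dependence (fun i => P (enum_val i)) Q lt.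
exists (fun x => G.@[fun i => x (enum_val i)]); split.
- by exists G.
- have [v hv] := meval_neq0 G0; exists (fun x => v (enum_rank x)).
  apply: contra_neq hv => <-; apply: meval_eq => i; by rewrite enum_valK.
move=> u; rewrite hQ => du; rewrite -[RHS](hG _ du).
by apply: meval_eq => i; rewrite hP.
Qed.

End PolynomialFunctions.

(** * Closed sets and thin properties *)

Section VectorSpace.
Variables (K : numFieldType) (V : vectType K).
Implicit Types (g : V -> K) (P : V -> Prop).

Let coords (v : V) : 'I_(\dim {:V}) -> K := fun i => coord (vbasis {:V}) i v.

Definition vpolyfun g : Prop :=
  exists2 f : ('I_(\dim {:V}) -> K) -> K, polyfun f & forall v, g v = f (coords v).

Lemma vpolyfun_mpoly g : vpolyfun g ->
  exists P : {mpoly K[\dim {:V}]}, forall v, g v = P.@[coords v].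
Proof.
move=> [f [P hP] hg].
exists (P \mPo [tuple 'X_(enum_val i) | i < #|'I_(\dim {:V})|]) => v.
rewrite comp_mpoly_meval hg hP; apply: meval_eq => i.
by rewrite tnth_mktuple mevalXU.
Qed.

Lemma vpolyfunM g h : vpolyfun g -> vpolyfun h -> vpolyfun (fun v => g v * h v).
Proof.
move=> [f pf hf] [f' pf' hf']; exists (fun u => f u * f' u) => [|v].
  exact: polyfunM.
by rewrite hf hf'.
Qed.

Lemma vpolyfun_comp (J : finType) (f : (J -> K) -> K) (g : J -> V -> K) :
  polyfun f -> (forall j, vpolyfun (g j)) -> vpolyfun (fun v => f (fun j => g j v)).
Proof.
move=> pf h.
have /choice[g' hg'] : forall j, exists g' : ('I_(\dim {:V}) -> K) -> K, polyfun g'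
  /\ forall v, g j v = g' (coords v).
  by move=> j; have [g' ? ?] := h j; exists g'.
exists (fun u => f (fun j => g' j u)).
  by apply: polyfun_comp => // j; case: (hg' j).
move=> v; congr f; apply/funext => j; by case: (hg' j).
Qed.

Lemma vpolyfun_linear (g : {scalar V}) : vpolyfun g.
Proof.
exists (fun u : 'I_(\dim {:V}) -> K => \sum_i u i * g (vbasis {:V})`_i).
  apply: polyfun_sum => i; apply: polyfunM; [exact: polyfun_coord|exact: polyfun_cst].
move=> v; rewrite {1}(coord_vbasis (memvf v)) linear_sum; apply: eq_bigr => i _.
by rewrite linearZ.
Qed.

(** The coefficients of [g x (c *: v)] as a polynomial in [c] are the values at [v] of the
    homogeneous components of [g x]; these components are the equations. *)
Lemma zclosed_scaled_zeros (X : Type) (g : X -> V -> K) :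
  (forall x, vpolyfun (g x)) ->
  zclosed [set v : V | v != 0 /\ forall x c, c != 0 -> g x (c *: v) = 0].
Proof.
move=> pg; have /choice[P hP] := fun x => vpolyfun_mpoly (pg x).
exists [set G | exists x e, G = pihomog mdeg e (P x)].
  by move=> _ [x [e ->]]; exists e; exact: pihomogP.
have E x c v : g x (c *: v) = (\sum_(e < msize (P x))
    (pihomog mdeg e (P x)).@[coords v] *: 'X^e).[c].
  rewrite hP horner_sum {1}(pihomog_partitionE (leqnn (msize (P x)))).
  rewrite linear_sum; apply: eq_bigr => e _ /=.
  rewrite !hornerE mulrC -homog_meval_scale ?pihomogP //.
  by apply: meval_eq => i; rewrite /coords linearZ.
apply/seteqP; split=> v [v0 h]; split=> //.
  move=> _ [x [e ->]].
  have p0 : \sum_(e < msize (P x))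
      (pihomog mdeg e (P x)).@[coords v] *: 'X^e = 0 :> {poly K}.
    by apply: poly_eq_nonzero => c c0; rewrite -E h // horner0.
  have [he|he] := ltnP e (msize (P x)); last first.
    rewrite pihomogE big_seq_cond big1 ?meval0 // => m /andP[mP /eqP me].
    by have := msize_mdeg_lt mP; rewrite me ltnNge he.
  move/(congr1 (fun p : {poly K} => p`_e)): p0.
  rewrite coef0 coef_sum (bigD1 (Ordinal he)) //= coefZ coefXn eqxx mulr1.
  rewrite big1 ?addr0 // => i ne; rewrite coefZ coefXn.
  by case: eqP => [ie|]; rewrite ?mulr0 //; case/eqP: ne; apply/val_inj.
move=> x c c0; rewrite E horner_sum big1 // => e _.
by rewrite !hornerE h ?mul0r //; exists x, e.
Qed.

(* [g] need not be homogeneous: letting [c] vary cuts out the common zeros of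
   its homogeneous components. *)
Definition thin P : Prop :=
  exists2 g, vpolyfun g & (exists v, g v != 0) /\
    forall v, P v -> forall c, c != 0 -> g (c *: v) = 0.

Lemma thin_or P P' : thin P -> thin P' -> thin (fun v => P v \/ P' v).
Proof.
move=> [g pg [[v gv] hg]] [g' pg' [[v' gv'] hg']].
exists (fun v => g v * g' v); first exact: vpolyfunM.
split; last first.
  by move=> w [/hg h|/hg' h] c c0; rewrite h // ?mul0r ?mulr0.
case: pg pg' => [f pf hf] [f' pf' hf'].
have [||u hu] := polyfun_mul_neq0 pf pf'.
- by exists (coords v); rewrite -hf.
- by exists (coords v'); rewrite -hf'.
exists (\sum_i u i *: (vbasis {:V})`_i); rewrite hf hf'.
suff -> : coords (\sum_i u i *: (vbasis {:V})`_i) = u by [].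
apply/funext => i; rewrite /coords coord_sum_free //.
exact: basis_free (vbasisP _).
Qed.

Lemma thin_sub P P' : (forall v, P v -> P' v) -> thin P' -> thin P.
Proof.
by move=> h [g pg [n0 hg]]; exists g => //; split=> // v /h; exact: hg.
Qed.

Lemma thin_ex (I : finType) (P : I -> V -> Prop) :
  (forall i, thin (P i)) -> thin (fun v => exists i, P i v).
Proof.
move=> h; apply: (@thin_sub _ (fun v => exists2 i, i \in enum I & P i v)).
  by move=> v [i iP]; exists i; rewrite ?mem_enum.
elim: (enum I) => [|i s IH].
  exists (fun=> 1); first by exists (fun=> 1) => //; exact: polyfun_cst.
  by split=> [|v []//]; exists 0; exact: oner_neq0.
apply: thin_sub (thin_or (h i) IH) => v [j]; rewrite inE => /predU1P[->|];
  first by left.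
by right; exists j.
Qed.

Lemma for_general_thin P P' : (exists v : V, v != 0) -> thin P ->
  (forall v, v != 0 -> ~ P v -> P' v) -> for_general (proj_space V) P'.
Proof.
move=> [w w0] [g pg [[v gv] hg]] h.
have cZ := @zclosed_scaled_zeros unit (fun=> g) (fun=> pg).
exists (proj_space V `\` [set v | v != 0 /\ forall x : unit, forall c, c != 0 -> g
  (c *: v) = 0]).
split; first by eexists; first exact: cZ.
- suff [u u0 gu] : exists2 u, u != 0 & g u != 0.
    exists u; split=> //; split=> // -[_ /(_ tt 1 (oner_neq0 _))].
    by rewrite scale1r => /eqP; rewrite (negbTE gu).
  (* If [g] is only known to be nonzero at the origin, its restriction to the line of [w] is a
     nonzero polynomial, hence nonzero at some [c *: w] with [c != 0]. *)
  have [v0|v0] := eqVneq v 0; last by exists v.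
  have [f pf hf] := pg.
  have [q hq] := polyfun_horner (fun i => (coords w i)%:P * 'X) pf.
  have gq c : g (c *: w) = q.[c].
    rewrite hf -hq; congr f; apply/funext => i.
    by rewrite /coords linearZ !hornerE mulrC.
  have q0 : q != 0.
    by apply: contraNneq gv => q0; rewrite v0 -(scale0r w) gq q0 horner0.
  have [c c0 hc] := poly_nonroot_neq0 q0.
  by exists (c *: w); rewrite ?gq // scaler_eq0 negb_or c0.
move=> u u0 [_ hu]; apply: h => // Pu; apply: hu; split=> // _ c c0.
exact: hg.
Qed.

End VectorSpace.

(** * Incidence varieties with linear fibres *)

Lemma row_free_widen (F : fieldType) (k m n : nat) (le : (k <= m)%N)
    (A : 'M[F]_(m, n)) : row_free A -> row_free (rowsub (widen_ord le) A).
Proof.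
move=> /row_freeP[C hC]; apply/row_freeP; exists (C *m colsub (widen_ord le) 1%:M).
rewrite mulmxA (rowsubE (widen_ord le)) -(mulmxA _ _ C) hC mulmx1.
apply/matrixP => i j; rewrite !mxE (bigD1 (widen_ord le i)) //= big1.
  by rewrite !mxE eqxx mul1r addr0 -val_eqE.
by move=> l hl; rewrite !mxE eq_sym (negbTE hl) mul0r.
Qed.

Lemma row_free_rcons (F : fieldType) (m k : nat) (A : 'M[F]_(m, k)) (v : 'rV[F]_k) :
  row_free A -> ~~ (v <= A)%MS -> row_free (col_mx A v).
Proof.
move=> fA vA; rewrite /row_free eqn_leq rank_leq_row -addsmxE addn1 -[X in (X <
  _)%N](eqP fA).
by rewrite rank_ltmx // ltmxE addsmxSl addsmx_sub submx_refl.
Qed.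

Lemma row_free_next (F : fieldType) (k i : nat) (ys : nat -> 'rV[F]_k) :
  row_free (\matrix_(e < i) ys e) -> ~~ (ys i <= \matrix_(e < i) ys e)%MS ->
  row_free (\matrix_(e < i.+1) ys e).
Proof.
move=> fM yM; have := row_free_rcons fM yM.
rewrite /row_free !eqn_leq !rank_leq_row /= {1}addn1 => /leq_trans; apply.
apply: mxrankS; rewrite -addsmxE addsmx_sub; apply/andP; split.
  apply/row_subP => e; have <- : row (widen_ord (leqnSn i) e) (\matrix_(e < i.+1)
    ys e) =
    row e (\matrix_(e < i) ys e) by rewrite !rowK.
  exact: row_sub.
by rewrite (_ : ys i = row ord_max (\matrix_(e < i.+1) ys e)) ?row_sub // rowK.
Qed.

Lemma not_row_full (F : fieldType) (m k : nat) (A : 'M[F]_(m, k)) : ~~ row_full A ->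
  exists2 l : 'cV_k, l != 0 & A *m l = 0.
Proof.
rewrite -cokermx_eq0 => c0.
have [j hj] : exists j, col j (cokermx A) != 0.
  apply: contrapT => /forallNP h; case/eqP: c0; apply/matrixP => i j.
  by have /negP/negPn/eqP/colP/(_ i) := h j; rewrite !mxE.
exists (col j (cokermx A)) => //.
by rewrite colE mulmxA mulmx_coker mul0mx.
Qed.

Lemma row_free_join_mx (F : fieldType) (n c : nat) (p : 'rV[F]_n.+1)
    (B : 'M[F]_(n, n.+1)) (M : 'M[F]_(c, n)) :
  (col_mx p B : 'M[F]_n.+1) \in unitmx -> row_free M ->
  row_free (col_mx p (M *m B)).
Proof.
move=> uB fM; have -> : col_mx p (M *m B) =
    block_mx 1%:M 0 0 M *m (col_mx p B : 'M[F]_(1 + n, n.+1)).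
  by rewrite mul_block_col mul1mx !mul0mx addr0 add0r.
rewrite /row_free mxrankMfree ?row_free_unit //.
by rewrite rank_diag_block_mx mxrank1 (eqP fM).
Qed.

Lemma row_free_join (F : fieldType) (n : nat) (p : 'rV[F]_n.+1)
    (B : 'M[F]_(n, n.+1)) (y : 'rV[F]_n) :
  (col_mx p B : 'M[F]_n.+1) \in unitmx -> y != 0 -> row_free (col_mx p (y *m B)).
Proof. by move=> uB y0; apply: row_free_join_mx; rewrite // /row_free rank_rV y0. Qed.

(** Conditions at given points are tested on products of the linear forms dual to a frame extending
    these points. *)
Lemma complete_frame (K : fieldType) (k N : nat) (kN : (k <= N)%N)
    (M : 'M[K]_(k, N)) : row_free M ->
  exists2 g : 'M[K]_N, g \in unitmx & forall i, row (widen_ord kN i) g = row i M.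
Proof.
move=> fM.
have rC : (\rank (M^C)%MS = N - k)%N by rewrite mxrank_compl (eqP fM).
have e : (k + \rank (M^C)%MS = N)%N by rewrite rC subnKC.
exists (castmx (e, erefl) (col_mx M (row_base (M^C)%MS))).
  rewrite -row_full_unit row_full_castmx -sub1mx.
  apply: submx_trans (_ : (M + M^C <= _)%MS).
    by rewrite sub1mx addsmx_compl_full.
  by rewrite -addsmxE addsmxS // eq_row_base.
move=> i; apply/rowP => j; rewrite !mxE castmxE /= cast_ord_id.
by rewrite (_ : cast_ord _ _ = lshift _ i) ?col_mxEu //; exact/val_inj.
Qed.

Section Incidence.
Variables (K : numFieldType) (V : vectType K).

(** Rank at least [k] of a family of functionals, witnessed by independent linear combinations:
    these can be taken along an adapted frame while [phi] itself stays polynomial in the standard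
    coordinates. *)
Definition functional_rank_ge (R : finType) (phi : R -> V -> K) (k : nat) : Prop :=
  exists (E : finType) (A : E -> R -> K), (k <= #|E|)%N /\
    forall c : E -> K,
      (forall v, \sum_e c e * (\sum_r A e r * phi r v) = 0) -> forall e, c e = 0.

(** The nonzero minor serves as the denominator in Cramer's rule when [k] coordinates of a solution
    are expressed through the others. *)
Lemma functional_rank_ge_minor (R : finType) (phi : R -> V -> K) (k : nat) :
  (forall r, scalar (phi r)) -> functional_rank_ge phi k ->
  exists (f : 'I_k -> R) (g : 'I_k -> 'I_(\dim {:V})), injective g /\
    \det (\matrix_(a, b) phi (f a) (vbasis {:V})`_(g b)) != 0.
Proof.
move=> lin [E [A [kE indep]]].
pose M : 'M[K]_(#|R|, \dim {:V}) :=
  \matrix_(r, j) phi (enum_val r) (vbasis {:V})`_j.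
have phiE r v : phi r v = \sum_j coord (vbasis {:V}) j v * phi r (vbasis {:V})`_j.
  pose h : {scalar V} := HB.pack (phi r) (GRing.isLinear.Build _ _ _ _ _ (lin r)).
  rewrite -[phi r v]/(h v) {1}(coord_vbasis (memvf v)) linear_sum.
  by apply: eq_bigr => j _; rewrite linearZ.
have rM : (k <= \rank M)%N.
  apply: leq_trans kE _.
  pose B : 'M[K]_(#|E|, #|R|) := \matrix_(e, r) A (enum_val e) (enum_val r).
  suff /eqP <- : row_free (B *m M) by rewrite mxrankM_maxr.
  rewrite -kermx_eq0; apply/eqP/row_matrixP => i; rewrite row0.
  set c := row i _; have : c *m (B *m M) = 0 by rewrite /c -row_mul mulmx_ker row0.
  move=> /rowP hc; apply/rowP => e; rewrite [RHS]mxE.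
  rewrite -[e]enum_valK; apply: (indep (fun e => c 0 (enum_rank e))) => v.
  transitivity (\sum_j coord (vbasis {:V}) j v * (c *m (B *m M)) 0 j); last first.
    by rewrite big1 // => j _; rewrite hc mxE mulr0.
  under [RHS]eq_bigr => j _.
    rewrite mxE mulr_sumr (reindex (@enum_rank E)) /=; last first.
      by apply: onW_bij; exists enum_val; [exact: enum_rankK|exact: enum_valK].
    over.
  rewrite exchange_big /=; apply: eq_bigr => e' _.
  transitivity (c 0 (enum_rank e') * \sum_j coord (vbasis {:V}) j v *
      (B *m M) (enum_rank e') j); last first.
    by rewrite mulr_sumr; apply: eq_bigr => j _; rewrite mulrCA.
  congr (_ * _); under [RHS]eq_bigr => j _.
    rewrite mxE mulr_sumr (reindex (@enum_rank R)) /=; last first.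
      by apply: onW_bij; exists enum_val; [exact: enum_rankK|exact: enum_valK].
    over.
  rewrite exchange_big /=; apply: eq_bigr => r _; rewrite phiE mulr_sumr.
  by apply: eq_bigr => j _; rewrite !mxE !enum_rankK mulrCA.
have [f1 f2] : exists f : 'I_k -> 'I_#|R|, row_free (rowsub f M).
  exists (maxrankfun M \o widen_ord rM).
  by rewrite rowsub_comp row_free_widen // maxrowsub_free.
have full : row_full (rowsub f1 M)^T by rewrite /row_full mxrank_tr.
pose g := fullrankfun full.
exists (fun a => enum_val (f1 a)), g; split; first exact: fullrankfun_inj.
have := fullrowsub_unit full; rewrite unitmxE unitfE -det_tr.
by congr (_ != 0); congr (\det _); apply/matrixP => a b; rewrite !mxE.
Qed.

(* Over a fixed parameter the solutions form a space of codimension [k], so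
   after forgetting all parameters but those in [T] the incidence variety has
   dimension less than [#|T| + \dim V]; if every fibre over [P] is dense in
   [K ^ T], its projection to [V] cannot be dense. *)
Lemma thin_incidence (I T X R : finType) (iota : X -> T -> I)
    (phi : R -> (I -> K) -> V -> K) (k : nat) (P : V -> Prop) :
  (forall r u, scalar (phi r u)) ->
  (forall r v, polyfun (fun u => phi r u v)) ->
  (#|I| < k + #|T|)%N ->
  (forall v, P v -> forall Q : (T -> K) -> K, polyfun Q -> (exists h, Q h != 0) ->
    exists x u, [/\ Q (u \o iota x) != 0, forall r, phi r u v = 0 &
      functional_rank_ge (phi ^~ u) k]) ->
  thin P.
Proof.
move=> lin pol lt dense.
pose N := \dim {:V}.
pose co (v : V) : 'I_N -> K := fun i => coord (vbasis {:V}) i v.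
have phiE r u v : phi r u v = \sum_j co v j * phi r u (vbasis {:V})`_j.
  pose h : {scalar V} := HB.pack (phi r u) (GRing.isLinear.Build _ _ _ _ _ (lin r u)).
  rewrite -[phi r u v]/(h v) {1}(coord_vbasis (memvf v)) linear_sum.
  by apply: eq_bigr => j _; rewrite linearZ.
pose pt (h : T -> K) (v : V) (z : T + 'I_N) : K :=
  match z with inl t => h t | inr j => co v j end.
pose D (x : X * {ffun 'I_k -> R} * {ffun 'I_k -> 'I_N}) (u : I -> K) :=
  \det (\matrix_(a, b) phi (x.1.2 a) u (vbasis {:V})`_(x.2 b)).
(* On the chart where the minor [D x] is nonzero, Cramer's rule recovers the coordinates of [v]
   indexed by [x.2] from [u] and the other coordinates. The point [pt] is thus a rational function
   of [#|I| + N - k] variables with values in dimension [#|T| + N], which is larger, so it satisfies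
   a relation [G]. *)
have chart (x : X * {ffun 'I_k -> R} * {ffun 'I_k -> 'I_N}) : exists G : (T + 'I_N
  -> K) -> K, [/\ polyfun G,
    exists z, G z != 0 &
    injective x.2 -> forall u v, (forall r, phi r u v = 0) -> D x u != 0 ->
      G (pt (u \o iota x.1.1) v) = 0].
  case: x => [[x f] g].
  have [/injectiveP gI|gI] := boolP (injectiveb g); last first.
    exists (fun=> 1); split; first exact: polyfun_cst.
      by exists (fun=> 0); exact: oner_neq0.
    by move=> /injectiveP /(negP gI).
  pose J := {j : 'I_N | j \notin codom g}.
  pose A (w : I + J -> K) : 'M[K]_k :=
    \matrix_(a, b) phi (f a) (w \o inl) (vbasis {:V})`_(g b).
  pose s (w : I + J -> K) a :=
    - \sum_(l : J) w (inr l) * phi (f a) (w \o inl) (vbasis {:V})`_(val l).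
  pose F (z : T + 'I_N) (w : I + J -> K) : K :=
    match z with
    | inl t => w (inl (iota x t)) * \det (A w)
    | inr j => match [pick b | g b == j] with
               | Some b => \sum_a (\adj (A w)) b a * s w a
               | None => if insub j is Some l then w (inr l) * \det (A w) else 0
               end
    end.
  have pphi r v : polyfun (fun w : I + J -> K => phi r (w \o inl) v).
    apply: (polyfun_comp (g := fun i w => w (inl i)) (pol r v)) => i.
    exact: polyfun_coord.
  have pA a b : polyfun (fun w => A w a b).
    by apply: (polyfun_ext _ (pphi (f a) (vbasis {:V})`_(g b))) => w; rewrite mxE.
  have pdet : polyfun (fun w => \det (A w)) by exact: polyfun_det.
  have pF z : polyfun (F z).
    case: z => [t|j]; rewrite /F /=; first by apply: polyfunM => //;
      exact: polyfun_coord.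
    case: [pick b | g b == j] => [b|].
apply: polyfun_sum => a; apply: polyfunM; first exact: polyfun_adj.
      apply: polyfunN; apply: polyfun_sum => l.
      by apply: polyfunM => //; exact: polyfun_coord.
    case: (insub j) => [l|]; last exact: polyfun_cst.
    by apply: polyfunM => //; exact: polyfun_coord.
  have [|G [pG G0 hG]] := polyfun_dependence pF pdet.
    rewrite !card_sum card_ord card_sig.
    have := cardC (mem (codom g)); rewrite card_ord card_codom // card_ord.
    have -> : #|predC (mem (codom g))| = #|[pred j | j \notin codom g]| by apply:
      eq_card.
    by move: lt; clear; lia.
  exists G; split=> // _ u v hv; rewrite /D /= => d0.
  pose w (z : I + J) : K :=
    match z with inl i => u i | inr l => co v (val l) end.
  have Aw : A w = \matrix_(a, b) phi (f a) u (vbasis {:V})`_(g b) by [].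
  have := hG w; rewrite Aw => /(_ d0) <-; congr G; apply/funext => -[t|j] /=.
    by rewrite mulfK // Aw.
  case: pickP => [b /eqP <-|nj]; last first.
    have jJ : j \notin codom g.
      by apply/codomP => -[b jb]; have := nj b; rewrite jb eqxx.
    by rewrite (insubT (fun j => j \notin codom g) jJ) /= Aw mulfK.
  apply: (mulIf d0); rewrite mulfVK // -Aw.
  have sw a : s w a = \sum_b co v (g b) * A w a b.
    apply/eqP; rewrite /s eq_sym -addr_eq0.
    have := hv (f a); rewrite phiE (bigID (mem (codom g))) /= => E;
      rewrite -[X in _ == X]E.
    apply/eqP; congr (_ + _).
      rewrite (eq_bigl (mem [set g b | b : 'I_k])); last first.
        by move=> i; apply/codomP/imsetP => -[b']; [exists b' | exists b'].
      rewrite big_imset /=; last by move=> ? ? _ _; exact: gI.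
      by apply: eq_bigr => c _; rewrite mxE.
    rewrite [RHS](reindex_omap (op := +%R) (val : J -> 'I_N) insub) /=; last first.
      by move=> i hi; rewrite (insubT (fun j => j \notin codom g) hi).
    apply: eq_big => [l|l _] //.
    by rewrite (valP l) valK eqxx.
  under eq_bigr do rewrite sw mulr_sumr.
  rewrite exchange_big /=.
  transitivity (\sum_c co v (g c) * (\adj (A w) *m A w) b c).
    rewrite mul_adj_mx (bigD1 b) //= !mxE eqxx mulr1n big1 ?addr0 // => c cb.
    by rewrite !mxE eq_sym (negbTE cb) mulr0n mulr0.
  apply: eq_bigr => c _; rewrite mxE mulr_sumr; apply: eq_bigr => a _.
  by rewrite mulrCA.
have [G hG] := choice chart.
have [|x|z hz] := @polyfun_prod_neq0 _ _ _ G.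
- by move=> x; case: (hG x).
- by case: (hG x).
(* The coordinates in [T] are frozen at those of [z], where no [G x] vanishes; this leaves a nonzero
   polynomial in [v] alone. *)
exists (fun v => \prod_x G x (pt (fun t => z (inl t)) v)).
  exists (fun y => \prod_x G x (fun s => match s with inl t => z (inl t) | inr j =>
    y j end)).
    apply: polyfun_prod => x; have [pG _ _] := hG x.
    apply: (polyfun_comp (g := fun s y => match s with inl t => z (inl t) | inr j
      => y j end) pG) => -[t|j].
      exact: polyfun_cst.
    exact: polyfun_coord.
  by move=> v; apply: eq_bigr => x _.
split.
  exists (\sum_(i < N) z (inr i) *: (vbasis {:V})`_i).
  apply/prodf_neq0 => x _; apply: contra_neq (hz x) => <-.
  congr (G x); apply/funext => -[t|j] //=.
  by rewrite /co coord_sum_free //; exact: basis_free (vbasisP _).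
move=> v Pv c c0; apply/eqP; apply: contraT => n0.
(* With the coordinates in [T] set free again, the product is a polynomial in [h] that is nonzero at
   those of [z]. Density then gives a solution at which it does not vanish, contradicting the
   relation on the chart of a nonzero minor; the conditions, being linear, pass from [v] to
   [c *: v]. *)
have pQ : polyfun (fun h => \prod_x G x (pt h (c *: v))).
  apply: polyfun_prod => x; have [pG _ _] := hG x.
  apply: (polyfun_comp (g := fun s h => pt h (c *: v) s) pG) => -[t|j].
    exact: polyfun_coord.
  exact: polyfun_cst.
have [|x [u [Qu hu rk]]] := dense v Pv _ pQ.
  by exists (fun t => z (inl t)).
have [f [g [gI dg]]] := functional_rank_ge_minor (fun r => lin r u) rk.
pose y := (x, finfun f, finfun g); have [_ _ /(_ _ u (c *: v)) h] := hG y.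
move/prodf_neq0: Qu => /(_ y isT)/eqP; case; apply: h => [a b| r|].
- by rewrite !ffunE => /gI.
- have := lin r u c v 0; rewrite addr0 hu mulr0 => ->; rewrite add0r.
  by rewrite phiE big1 // => j _; rewrite /co linear0 mul0r.
rewrite /D /=; apply: contra_neq dg => <-; congr (\det _).
by apply/matrixP => a b; rewrite !mxE !ffunE.
Qed.

End Incidence.

(** * Restriction of forms to a line *)

Section Forms.
Variables (K : numFieldType) (N : nat).
Implicit Types (F G : {mpoly K[N]}) (p q v w z : 'rV[K]_N).

Lemma mpoly_ring_ind (P : {mpoly K[N]} -> Prop) :
  (forall c, P c%:MP) -> (forall i, P 'X_i) ->
  (forall F G, P F -> P G -> P (F + G)) -> (forall F G, P F -> P G -> P (F * G)) ->
  forall F, P F.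
Proof.
move=> PC PX PD PM; elim/mpolyind => [|c m F _ _ PF]; first by rewrite -mpolyC0.
apply: (PD) => //; rewrite -mul_mpolyC; apply: (PM) => //.
rewrite mpolyXE_id; apply: (big_ind P) => [|F1 F2|i _];
  [by rewrite -mpolyC1|exact: PM|].
elim: (m i) => [|k IH]; first by rewrite expr0 -mpolyC1.
by rewrite exprS; apply: PM.
Qed.

Definition dirder v F : {mpoly K[N]} := \sum_i v 0 i *: F^`M(i).

Lemma dirderM v F G : dirder v (F * G) = dirder v F * G + F * dirder v G.
Proof.
rewrite /dirder mulr_suml mulr_sumr -big_split /=; apply: eq_bigr => i _.
by rewrite mderivM scalerDr scalerAl scalerAr.
Qed.

Lemma dirder_is_linear v : linear (dirder v).
Proof.
move=> c F G; rewrite /dirder scaler_sumr -big_split /=; apply: eq_bigr => i _.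
by rewrite mderivD mderivZ scalerDr !scalerA mulrC.
Qed.

HB.instance Definition _ v :=
  GRing.isLinear.Build K {mpoly K[N]} {mpoly K[N]} _ (dirder v)
    (dirder_is_linear v).

Lemma dirderC v c : dirder v c%:MP = 0.
Proof. by rewrite /dirder big1 // => i _; rewrite mderivC scaler0. Qed.

Lemma dirderXU v i : dirder v 'X_i = (v 0 i)%:MP.
Proof.
rewrite /dirder (bigD1 i) //= big1 => [|j ji].
  rewrite addr0 mderivX mnmE eqxx scale1r.
  rewrite (_ : (U_(i) - U_(i))%MM = 0%MM); last first.
    by apply/mnmP => j; rewrite mnmBE subnn mnm0E.
  by rewrite mpolyX0 -mul_mpolyC mulr1.
by rewrite mderivX mnmE eq_sym (negbTE ji) scale0r scaler0.
Qed.

Lemma dirderX v F k : dirder v (F ^+ k) = (dirder v F * F ^+ k.-1) *+ k.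
Proof.
elim: k => [|k IH]; first by rewrite expr0 -mpolyC1 dirderC.
rewrite exprS dirderM IH mulrnAr /= mulrS; congr (_ + _).
case: k {IH} => [|k]; first by rewrite !mulr0n.
by rewrite /= exprS mulrCA.
Qed.

Lemma dirder_suml (I : Type) (r : seq I) (P : pred I) (c : I -> K) (v : I -> 'rV_N) F :
  dirder (\sum_(i <- r | P i) c i *: v i) F =
  \sum_(i <- r | P i) c i *: dirder (v i) F.
Proof.
under [RHS]eq_bigr do rewrite scaler_sumr.
rewrite exchange_big; apply: eq_bigr => j _ /=.
rewrite summxE scaler_suml; apply: eq_bigr => i _.
by rewrite mxE scalerA.
Qed.

Lemma dirder_delta i F : dirder (delta_mx 0 i) F = F^`M(i).
Proof.
rewrite /dirder (bigD1 i) //= big1 ?addr0 => [|j ji]; rewrite !mxE ?eqxx ?scale1r //.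
by rewrite (negbTE ji) andbF scale0r.
Qed.

Lemma dirderZl c v F : dirder (c *: v) F = c *: dirder v F.
Proof. by have := dirder_suml (index_enum 'I_1) predT (fun=> c) (fun=> v) F;
  rewrite !big_ord1. Qed.

Lemma dirderDl v w F : dirder (v + w) F = dirder v F + dirder w F.
Proof. by rewrite /dirder -big_split; apply: eq_bigr => i _; rewrite mxE scalerDl. Qed.

Lemma dirder_comm v w F : dirder v (dirder w F) = dirder w (dirder v F).
Proof.
rewrite /dirder.
under eq_bigr => i _ do rewrite (linear_sum (mderiv i)) scaler_sumr.
under [RHS]eq_bigr => i _ do rewrite (linear_sum (mderiv i)) scaler_sumr.
rewrite exchange_big; apply: eq_bigr => i _ /=; apply: eq_bigr => j _ /=.
by rewrite !mderivZ !scalerA mulrC mderiv_comm.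
Qed.

Lemma mderiv_homog d i F : F \is d.+1.-homog -> F^`M(i) \is d.-homog.
Proof.
move=> /dhomogP h; apply/dhomogP => m.
rewrite mcoeff_msupp mcoeff_deriv => m0.
have : (m + U_(i))%MM \in msupp F.
  by rewrite mcoeff_msupp; apply: contraNneq m0 => ->; rewrite mul0rn.
by move/h; rewrite /= mdegD mdeg1 addn1 => -[].
Qed.

Lemma dirder_homog d v F : F \is d.+1.-homog -> dirder v F \is d.-homog.
Proof.
by move=> h; apply: rpred_sum => i _; apply: rpredZ; exact: mderiv_homog.
Qed.

(** The dehomogenised restriction to the line through [p] and [z]: for [F] of degree [d],
    coefficient [k] is that of [x ^ (d - k) y ^ k] at [x p + y z], and coefficients 0 to [k] depend
    only on the [k]-jet at [p]. *)
Definition restr p z F : {poly K} :=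
  mmap (polyC : {rmorphism K -> {poly K}}) (fun i => (p 0 i)%:P + (z 0 i) *: 'X) F.

Lemma restrD p z F G : restr p z (F + G) = restr p z F + restr p z G.
Proof. exact: rmorphD. Qed.

Lemma restrM p z F G : restr p z (F * G) = restr p z F * restr p z G.
Proof. exact: rmorphM. Qed.

Lemma restrX p z F k : restr p z (F ^+ k) = restr p z F ^+ k.
Proof. exact: rmorphXn. Qed.

Lemma restrC p z c : restr p z c%:MP = c%:P.
Proof. exact: mmapC. Qed.

Lemma restr0 p z : restr p z 0 = 0.
Proof. exact: rmorph0. Qed.

Lemma restrZ p z c F : restr p z (c *: F) = c *: restr p z F.
Proof. by rewrite -mul_mpolyC restrM restrC mul_polyC. Qed.

Lemma restr_sum p z (I : Type) (r : seq I) (P : pred I) (F : I -> {mpoly K[N]}) :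
  restr p z (\sum_(i <- r | P i) F i) = \sum_(i <- r | P i) restr p z (F i).
Proof. exact: rmorph_sum. Qed.

Lemma restrXU p z i : restr p z 'X_i = (p 0 i)%:P + (z 0 i) *: 'X.
Proof. by rewrite /restr mmapX mmap1U. Qed.

Lemma horner_restr p z F t : (restr p z F).[t] = F.@[(p + t *: z) 0].
Proof.
elim/mpoly_ring_ind: F => [c|i|F G hF hG|F G hF hG].
- by rewrite restrC hornerC mevalC.
- by rewrite restrXU mevalXU !hornerE !mxE mulrC.
- by rewrite restrD hornerD hF hG mevalD.
- by rewrite restrM hornerM hF hG mevalM.
Qed.

Lemma coef0_restr p z F : (restr p z F)`_0 = F.@[p 0].
Proof. by rewrite -horner_coef0 horner_restr scale0r addr0. Qed.

Lemma deriv_restr p z F : (restr p z F)^`() = restr p z (dirder z F).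
Proof.
elim/mpoly_ring_ind: F => [c|i|F G hF hG|F G hF hG].
- by rewrite restrC derivC dirderC restr0.
- by rewrite restrXU derivD derivC derivZ derivX add0r dirderXU restrC alg_polyC.
- by rewrite restrD derivD hF hG linearD restrD.
- by rewrite restrM derivM hF hG dirderM restrD !restrM.
Qed.

Lemma coef1_restr p z F : (restr p z F)`_1 = (dirder z F).@[p 0].
Proof. by rewrite -(coef0_restr p z) -deriv_restr coef_deriv mulr1n. Qed.

Lemma homog_mevalZ d F c p : F \is d.-homog -> F.@[(c *: p) 0] = c ^+ d * F.@[p 0].
Proof.
move=> h; rewrite -(homog_meval_scale c (p 0) h); apply: meval_eq => i.
by rewrite mxE.
Qed.

Lemma size_restr d p z F : F \is d.-homog -> (size (restr p z F) <= d.+1)%N.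
Proof.
move=> /dhomogP h; rewrite (mpolyE F) restr_sum big_seq.
apply: (big_ind (fun q : {poly K} => (size q <= d.+1)%N)).
- by rewrite size_poly0.
- by move=> a b ha hb; apply: leq_trans (size_polyD _ _) _; rewrite geq_max ha.
move=> m /h <- {h}; rewrite restrZ; apply: leq_trans (size_scale_leq _ _) _.
rewrite /restr mmapX /mmap1 /= mdegE.
elim/big_ind2: _ => [|a i b j ha hb|i _]; first by rewrite size_poly1.
  apply: leq_trans (size_polyMleq _ _) _.
  by rewrite -subn1 leq_subLR add1n -addnS -addSn leq_add.
apply: leq_trans (size_poly_exp_leq _ _) _.
rewrite ltnS -[leqRHS]mul1n leq_mul2r -subn1 leq_subLR addn1; apply/orP; right.
apply: leq_trans (size_polyD _ _) _; rewrite geq_max.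
rewrite (leq_trans (size_polyC_leq1 _)) // (leq_trans (size_scale_leq _ _)) //.
by rewrite size_polyX.
Qed.

(* Both sides are polynomials in [x]; for [x != 0] homogeneity reduces the
   claim to [horner_restr]. *)
Lemma homog_meval_line d p z F x y : F \is d.-homog ->
  F.@[(x *: p + y *: z) 0] =
  \sum_(k < d.+1) (restr p z F)`_k * (x ^+ (d - k) * y ^+ k).
Proof.
move=> h; rewrite addrC -horner_restr.
transitivity (\sum_(k < d.+1) ((restr p z F)`_k * y ^+ k) *: 'X^(d - k)).[x].
  congr (horner _ x); apply: poly_eq_nonzero => c c0.
  rewrite horner_restr.
  have -> : y *: z + c *: p = c *: (p + (y / c) *: z).
    by rewrite scalerDr scalerA mulrCA mulfV // mulr1 addrC.
  rewrite (homog_mevalZ _ _ h) -horner_restr.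
  rewrite (horner_coef_wide _ (size_restr p z h)) mulr_sumr horner_sum.
  apply: eq_bigr => k _; rewrite !hornerE.
  have kd : (k <= d)%N by rewrite -ltnS.
  rewrite -[in c ^+ d](subnK kd) exprD expr_div_n.
  have ck : c ^+ k != 0 by rewrite expf_neq0.
  move: ck; move: (c ^+ _) (c ^+ _) (y ^+ _) (_`_k) => a b e f b0.
  by rewrite -[LHS]/(a * b * f * (e / b)); field.
rewrite horner_sum; apply: eq_bigr => k _.
by rewrite !hornerE mulrAC.
Qed.

(** Euler's identity, read off the linear coefficient of [F (p + t p) = (1 + t) ^ d F (p)]. *)
Lemma euler_homog d p F : F \is d.-homog -> (dirder p F).@[p 0] = d%:R * F.@[p 0].
Proof.
move=> h; rewrite -coef1_restr.
have -> : restr p p F = F.@[p 0] *: ('X + 1) ^+ d.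
  apply: poly_eq_nonzero => t _; rewrite horner_restr !hornerE.
  by rewrite -{1}(scale1r p) -scalerDl (homog_mevalZ _ _ h) addrC mulrC.
rewrite coefZ mulrC addrC exprDn coef_sum; congr (_ * _).
case: d h => [|d] h.
  by rewrite big_ord1 !expr0 mulr1 bin0 mulr1n coef1.
rewrite (bigD1 (lift ord0 ord0)) //= big1 => [|i i1].
  by rewrite expr1n mul1r addr0 coefMn expr1 coefX eqxx bin1.
rewrite expr1n mul1r coefMn coefXn; case: eqP => [e|_]; last by rewrite mul0rn.
by case/eqP: i1; apply/val_inj.
Qed.

Definition linform (c : 'cV[K]_N) : {mpoly K[N]} := \sum_i c i 0 *: 'X_i.

Lemma linform_homog c : linform c \is 1.-homog.
Proof. by apply: rpred_sum => i _; apply: rpredZ; rewrite dhomogX /= mdeg1. Qed.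

Lemma linformX_homog c k : linform c ^+ k \is k.-homog.
Proof. by have := dhomogMn k (linform_homog c); rewrite mul1n. Qed.

Lemma meval_linform c p : (linform c).@[p 0] = (p *m c) 0 0.
Proof.
by rewrite linear_sum mxE; apply: eq_bigr => i _; rewrite /= mevalZ mevalXU mulrC.
Qed.

Lemma dirder_linform v c : dirder v (linform c) = ((v *m c) 0 0)%:MP.
Proof.
rewrite linear_sum mxE rmorph_sum; apply: eq_bigr => i _ /=.
by rewrite linearZ /= dirderXU mulrC mpolyCM mul_mpolyC.
Qed.

Lemma restr_linform p z c :
  restr p z (linform c) = ((p *m c) 0 0)%:P + ((z *m c) 0 0) *: 'X.
Proof.
rewrite restr_sum !mxE rmorph_sum scaler_suml -big_split /=; apply: eq_bigr => i _.
rewrite restrZ restrXU scalerDr scalerA -mul_polyC -polyCM.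
by rewrite (mulrC (c i 0) (p 0 i)) (mulrC (c i 0) (z 0 i)).
Qed.

(** The coordinate form [x_a] of the frame [g]: it is 1 on row [a] and 0 on the other rows. *)
Definition dualform (g : 'M[K]_N) (a : 'I_N) := linform (col a (invmx g)).

Lemma row_mul_dual (g : 'M[K]_N) a b : g \in unitmx ->
  (row b g *m col a (invmx g)) 0 0 = (b == a)%:R.
Proof.
move=> hg; have /matrixP/(_ b a) := mulmxV hg; rewrite !mxE => <-.
by apply: eq_bigr => j _; rewrite !mxE.
Qed.

End Forms.

(** * Conditions violated by a general hypersurface *)

Section Gradient.
Variables (K : numFieldType) (n d : nat).
Implicit Types (p q v w : 'rV[K]_n.+1) (F G : {mpoly K[n.+1]}).

Lemma meval_dirder v F (u : 'I_n.+1 -> K) :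
  (dirder v F).@[u] = \sum_i v 0 i * (F^`M(i)).@[u].
Proof. by rewrite linear_sum; apply: eq_bigr => i _ /=; rewrite mevalZ. Qed.

Lemma mderiv_dirder v F i : (dirder v F)^`M(i) = dirder v F^`M(i).
Proof. by rewrite -!(dirder_delta i) dirder_comm. Qed.

Lemma dualformX_homog (g : 'M[K]_n.+1) P k : dualform g P ^+ k \is k.-homog.
Proof. exact: linformX_homog. Qed.

Lemma dualform_mul_homog (g : 'M[K]_n.+1) a k F : F \is k.-homog ->
  dualform g a * F \is k.+1.-homog.
Proof. by move=> hF; exact: (dhomogM (linform_homog _) hF). Qed.

Lemma meval_dualform (g : 'M[K]_n.+1) a b : g \in unitmx ->
  (dualform g a).@[row b g 0] = (b == a)%:R.
Proof. by move=> hg; rewrite meval_linform row_mul_dual. Qed.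

Lemma dirder_dualform (g : 'M[K]_n.+1) a b : g \in unitmx ->
  dirder (row b g) (dualform g a) = ((b == a)%:R)%:MP.
Proof. by move=> hg; rewrite dirder_linform row_mul_dual. Qed.

Lemma dirder_dualform_mulX (g : 'M[K]_n.+1) (P a b : 'I_n.+1) k : g \in unitmx ->
  (dirder (row b g) (dualform g a * dualform g P ^+ k)).@[row P g 0] =
  (b == a)%:R * (if a == P then k.+1%:R else 1).
Proof.
move=> hg; rewrite dirderM dirderX !dirder_dualform // mulrnAr.
rewrite mevalD mevalMn !mevalM !rmorphXn /= !meval_dualform // !mevalC eqxx !expr1n.
rewrite !mulr1 [P == a]eq_sym; have [->|aP] := eqVneq a P.
  by rewrite mul1r mulr_natr mulrS.
by rewrite mul0r mul0rn addr0 mulr1.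
Qed.

Lemma dirder2_dualform_mul (g : 'M[K]_n.+1) (P a b c : 'I_n.+1) G :
  g \in unitmx -> a != P ->
  (dirder (row b g) (dirder (row c g) (dualform g a * G))).@[row P g 0] =
  (c == a)%:R * (dirder (row b g) G).@[row P g 0] +
  (b == a)%:R * (dirder (row c g) G).@[row P g 0].
Proof.
move=> hg aP; rewrite dirderM linearD /= !dirderM !dirder_dualform // dirderC.
rewrite !mevalD !mevalM !mevalC ?meval0 meval_dualform // [P == a]eq_sym (negbTE aP).
by rewrite !mul0r addr0 add0r.
Qed.

Lemma frame_through p : p != 0 ->
  exists2 g : 'M[K]_n.+1, g \in unitmx & row ord0 g = p.
Proof.
move=> p0; have fp : row_free p by rewrite /row_free rank_rV p0.
have [g hg h] := complete_frame (ltn0Sn n) fp.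
exists g => //; have := h ord0; rewrite row_id (_ : widen_ord _ _ = ord0) //.
exact/val_inj.
Qed.

(** In a frame starting with [p], the forms [x_e x_0 ^ (d - 1)] pair diagonally with the derivatives
    at [p] along the frame, with entry [d] at [e = 0] and 1 elsewhere. *)
Lemma gradient_rank p : (0 < d)%N -> p != 0 ->
  functional_rank_ge (fun r (F : dhomog n.+1 K d) => (F^`M(r)).@[p 0]) n.+1.
Proof.
move=> d0 p0; have [g hg gp] := frame_through p0.
exists 'I_n.+1, (fun e r => g e r); split; first by rewrite card_ord.
move=> c hc e.
have hT : dualform g e * dualform g ord0 ^+ d.-1 \is d.-homog.
  by have := dualform_mul_homog g e (dualformX_homog g ord0 d.-1); rewrite prednK.
have := hc (DHomog hT); set G := dualform g e * _ in hT *.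
rewrite (eq_bigr (fun i => c i * (dirder (row i g) G).@[row ord0 g 0])); last first.
  move=> i _; congr (_ * _); rewrite gp meval_dirder.
  by apply: eq_bigr => r _; rewrite mxE.
rewrite (bigD1 e) //= [X in _ + X]big1 ?addr0 => [/eqP|i ie]; last first.
  by rewrite dirder_dualform_mulX // (negbTE ie) mul0r mulr0.
rewrite mulf_eq0 => /orP[/eqP //|].
rewrite dirder_dualform_mulX // eqxx mul1r prednK //.
by case: ifP => _; rewrite ?oner_eq0 // pnatr_eq0 -[d == _]negbK -lt0n d0.
Qed.

(** There are [n + 1] conditions on the [n + 1] coordinates of [p], and rescaling [p] prescribes one
    coordinate: the count succeeds by exactly one. *)
Lemma thin_singular : (0 < d)%N ->
  thin (fun F : dhomog n.+1 K d =>
    exists2 p : 'rV_n.+1, p != 0 & forall i, (F^`M(i)).@[p 0] = 0).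
Proof.
move=> d0.
apply: (@thin_incidence _ _ 'I_n.+1 unit 'I_n.+1 'I_n.+1 (fun j _ => j)
  (fun r u (F : dhomog n.+1 K d) => (F^`M(r)).@[u]) n.+1).
- by move=> r u c F G; rewrite /= mderivD mderivZ mevalD mevalZ.
- by move=> r F; apply: polyfun_meval => i; exact: polyfun_coord.
- by rewrite card_ord card_unit addn1.
move=> F [p p0 hp] Q pQ Qn0.
(* The prescribed coordinate is also kept nonzero, so that the rescaled point is nonzero. *)
have [h] : exists h, Q h * h tt != 0.
  apply: polyfun_mul_neq0 => //; first exact: polyfun_coord.
  by exists (fun=> 1); exact: oner_neq0.
rewrite mulf_eq0 negb_or => /andP[Qh ht].
have [j pj] : exists j, p 0 j != 0 by apply/rV0Pn.
pose p' := (h tt / p 0 j) *: p.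
have p'0 : p' != 0 by rewrite scaler_eq0 negb_or p0 mulf_neq0 // invr_neq0.
exists j, (p' 0); split.
- rewrite (_ : _ \o _ = h) //; apply/funext => -[] /=.
  by rewrite mxE mulfVK.
- move=> r; have hF : (F : {mpoly K[n.+1]}) \is (d.-1.+1).-homog by rewrite prednK
  //; exact: dhomog_is_dhomog.
  by rewrite (homog_mevalZ _ _ (mderiv_homog r hF)) hp mulr0.
exact: gradient_rank.
Qed.

End Gradient.

(** * Points where the Hessian has large corank *)

Section Hessian.
Variables (K : numFieldType) (n d k : nat).
Hypotheses (d2 : (2 <= d)%N) (kn : (k < n.+1)%N).
Implicit Types (p v w : 'rV[K]_n.+1) (q : 'M[K]_(k, n.+1)) (F G : {mpoly K[n.+1]}).

Let R := (unit + 'I_k * 'I_n.+1)%type.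
Let hess_cond (r : R) (p : 'I_n.+1 -> K) (q : 'I_k -> 'I_n.+1 -> K) F : K :=
  match r with
  | inl _ => F.@[p]
  | inr ai => \sum_j q ai.1 j * (F^`M(ai.2)^`M(j)).@[p]
  end.

(** Symmetry of second derivatives makes the conditions [(a, b)] and [(b, a)] coincide when both
    indices are below [k]; [E] keeps one of them, together with [F (p) = 0]. *)
Let E := (unit + {x : 'I_k * 'I_n.+1 | (x.1 <= x.2)%N})%type.

(** In a frame made of [q], then [p], then a complement, the form [x_a x_b x_P ^ (d - 2)] vanishes
    at [p] and pairs nontrivially with the condition [(a, b)] only. Once these are eliminated,
    [x_P ^ d] detects the value at [p]. *)
Lemma hessian_rank p q : row_free (col_mx q p) ->
  functional_rank_ge
    (fun r (F : dhomog n.+1 K d) => hess_cond r (p 0) (fun a j => q a j) F) #|{: E}|.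
Proof.
move=> fqp; have kn1 : (k + 1 <= n.+1)%N by rewrite addn1.
have [g hg gE] := complete_frame kn1 fqp.
pose P := widen_ord kn1 (rshift k ord0).
pose al (a : 'I_k) := widen_ord kn1 (lshift 1 a).
have gP : row P g = p by rewrite gE rowKd row_id.
have gal a : row (al a) g = row a q by rewrite gE rowKu.
have alP a : (al a == P) = false.
  by apply/negbTE; rewrite -val_eqE /= addn0 neq_ltn ltn_ord.
exists E, (fun e r => match e, r with
  | inl _, inl _ => 1
  | inr x, inr ai => ((val x).1 == ai.1)%:R * g (val x).2 ai.2
  | _, _ => 0
  end); split=> // c hc.
pose val2 (x : {x : 'I_k * 'I_n.+1 | (x.1 <= x.2)%N}) F :=
  (dirder (row (val x).2 g) (dirder (row (al (val x).1) g) F)).@[p 0].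
have {}hc F : F \is d.-homog ->
    c (inl tt) * F.@[p 0] + \sum_x c (inr x) * val2 x F = 0.
  move=> hF; have := hc (DHomog hF); rewrite big_sumType /= => {2}<-.
  congr (_ + _).
    rewrite (big_pred1 tt) => [|[]//]; rewrite big_sumType /= (big_pred1 tt) => [|[]//].
    by rewrite mul1r big1 ?addr0 // => i _; rewrite mul0r.
  apply: eq_bigr => x _; congr (_ * _);
    rewrite big_sumType /= [X in _ = X + _]big1; last first.
    by move=> i _; rewrite mul0r.
  rewrite add0r -(pair_bigA _ (fun a i => ((val x).1 == a)%:R * g (val x).2 i *
    \sum_j q a j * (F^`M(i)^`M(j)).@[p 0])) /= (bigD1 (val x).1) //=.
  rewrite [X in _ = _ + X]big1 ?addr0 => [|a ax]; last first.
    by rewrite big1 // => i _; rewrite eq_sym (negbTE ax) !mul0r.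
  rewrite /val2 gal meval_dirder; apply: eq_bigr => i _.
  rewrite eqxx mul1r mxE; congr (_ * _); rewrite mderiv_dirder meval_dirder.
  by apply: eq_bigr => j _; rewrite mxE.
pose T a b := dualform g (al a) * (dualform g b * dualform g P ^+ (d - 2)).
have hT a b : T a b \is d.-homog.
  have := dualform_mul_homog g (al a) (dualform_mul_homog g b (dualformX_homog g P
    (d - 2))).
  by rewrite -[(d - 2).+2]add2n subnKC.
have valT x a b : val2 x (T a b) =
    ((al (val x).1 == al a)%:R * ((val x).2 == b)%:R +
     ((val x).2 == al a)%:R * (al (val x).1 == b)%:R) *
    (if b == P then (d - 2).+1%:R else 1).
  rewrite /val2 /T -gP dirder2_dualform_mul ?alP //.
  by rewrite !dirder_dualform_mulX // !mulrA -mulrDl.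
have cr (x : {x : 'I_k * 'I_n.+1 | (x.1 <= x.2)%N}) : c (inr x) = 0.
  case: x => [[a b] /= ab]; have := hc _ (hT a b).
  rewrite mevalM -{1}gP meval_dualform // [P == _]eq_sym alP mul0r mulr0 add0r.
  set x0 := exist _ _ _; rewrite (bigD1 x0) //= [X in _ + X]big1 ?addr0.
    rewrite valT /= !eqxx => /eqP; rewrite mulf_eq0 => /orP[/eqP //|].
    rewrite mulf_eq0 => /orP[|].
      by rewrite -!natrM -natrD pnatr_eq0.
    by case: ifP => _; rewrite ?oner_eq0 // pnatr_eq0.
  case=> [[a' b'] /= ab'] ne; rewrite valT /=.
  suff [-> ->] : (al a' == al a)%:R * (b' == b)%:R = 0 :> K /\
      (b' == al a)%:R * (al a' == b)%:R = 0 :> K by rewrite addr0 mul0r mulr0.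
  have alE : (al a' == al a) = (a' == a) by rewrite -val_eqE.
  have nab : ~~ ((a' == a) && (b' == b)).
    by apply: contra ne => /andP[/eqP e1 /eqP e2]; apply/eqP/val_inj; rewrite /= e1 e2.
  rewrite -!natrM !mulnb alE (negbTE nab); split=> //.
  (* This product is the transposed pair, which the ordering of the indices allows only on the
     diagonal. *)
  case: eqP => //= e1; case: eqP => //= e2.
  have aa : a' = a.
    apply/val_inj/anti_leq/andP; split.
      by rewrite (leq_trans ab') // e1.
    by rewrite (leq_trans ab) // -e2.
  by move: nab; rewrite -e2 e1 aa !eqxx.
have cl : c (inl tt) = 0.
  have := hc _ (dualformX_homog g P d).
  rewrite big1 ?addr0 => [|x _]; last by rewrite cr mul0r.
  by rewrite rmorphXn /= -gP meval_dualform // eqxx expr1n mulr1.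
by case=> [[]|x].
Qed.

(* A symmetric form of corank [k] satisfies [k (k + 1) / 2] conditions, and
   [F.@[p 0] = 0] is one more, while [p] moves in an [n]-dimensional space. *)
Lemma thin_hessian : (2 * n < 2 + k * k.+1)%N ->
  thin (fun F : dhomog n.+1 K d => exists (p : 'rV_n.+1) (q : 'M_(k, n.+1)),
    [/\ row_free (col_mx q p), F.@[p 0] = 0 &
      forall a i, (dirder (row a q) F^`M(i)).@[p 0] = 0]).
Proof.
move=> lt.
pose I := ('I_n.+1 + 'I_k * 'I_n.+1)%type.
(* Replacing [q] by [C *m q] with [C] invertible prescribes a [k] by [k] block of [q], and rescaling
   prescribes one coordinate of [p]. *)
pose T := ('I_k * 'I_k + unit)%type.
pose iota (x : {ffun 'I_k -> 'I_n.+1} * 'I_n.+1) (t : T) : I :=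
  match t with inl ab => inr (ab.1, x.1 ab.2) | inr _ => inl x.2 end.
pose phi (r : R) (u : I -> K) (F : dhomog n.+1 K d) :=
  hess_cond r (fun i => u (inl i)) (fun a i => u (inr (a, i))) F.
apply: (@thin_incidence _ _ I T _ R iota phi #|{: E}|).
- move=> [t|[a i]] u c F G; rewrite /phi /=; first by rewrite mevalD mevalZ.
  rewrite mulr_sumr -big_split /=; apply: eq_bigr => j _.
  by rewrite !(mderivD, mderivZ) mevalD mevalZ mulrDr mulrCA.
- have pm (G : {mpoly K[n.+1]}) : polyfun (fun u : I -> K => G.@[fun i => u (inl i)]).
    by apply: (@polyfun_meval _ _ _ G (fun i u => u (inl i))) => i;
      exact: polyfun_coord.
  move=> [t|[a i]] F; rewrite /phi /=; first exact: pm.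
  by apply: polyfun_sum => j; apply: polyfunM; [exact: polyfun_coord|exact: pm].
(* Here [#|E|] is [1 + k (n + 1) - k (k - 1) / 2], and [k ^ 2 + 1] coordinates are prescribed; what
   remains is [lt]. *)
- rewrite !card_sum !card_prod !card_ord !card_unit card_sig.
  have -> : #|[pred x : 'I_k * 'I_n.+1 | (x.1 <= x.2)%N]| = (\sum_(a < k) (n.+1 - a))%N.
    rewrite -sum1_card (eq_bigl (fun x : 'I_k * 'I_n.+1 => true && (x.1 <= x.2)%N)) //.
    rewrite -(pair_big_dep predT (fun (a : 'I_k) (b : 'I_n.+1) => (a <= b)%N) (fun
      _ _ => 1%N)) /=.
    apply: eq_bigr => a _; rewrite -(big_mkord (fun b => a <= b)%N (fun=> 1%N)).
    rewrite (@big_cat_nat _ _ _ a) //=; last by rewrite ltnW // (ltn_trans (ltn_ord a)).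
    rewrite big_nat_cond big1 => [|i /andP[/andP[_ ia] ai]]; last by move: ia;
      rewrite ltnNge ai.
    rewrite big_nat_cond (eq_bigl (fun i => (a <= i < n.+1)%N)); last first.
      by move=> i; case: (a <= i)%N; rewrite ?andbT.
    by rewrite -big_nat sum_nat_const_nat muln1.
  have /(_ _ (ltnW kn)) : forall m, (m <= n.+1)%N ->
      (2 * \sum_(a < m) (n.+1 - a) + m * m.-1 = 2 * m * n.+1)%N.
    elim=> [|m IH] mn; first by rewrite big_ord0.
    have := IH (ltnW mn); rewrite big_ord_recr /=; case: m mn {IH} => [|m] mn /=; nia.
  move: (\sum_(a < k) _)%N lt => s lt e; have : (k * k.-1 + k * 1 = k * k)%N.
    by case: (k) => [|k'] //=; rewrite -mulnDr addn1.
  move: lt e; rewrite mulnS; clear; move: (k * k.-1)%N (k * k)%N => x y; nia.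
move=> F [p [q [fqp Fp Hq]]] Q pQ Qn0.
have fq : row_free q.
  rewrite /row_free eqn_leq rank_leq_row /= -(leq_add2r 1%N).
  move/eqP: fqp => {1}<-; rewrite -addsmxE.
  by apply: leq_trans (mxrank_adds_leqif _ _) _; rewrite leq_add2l rank_leq_row.
have p0 : p != 0.
  apply: contraTneq fqp => ->; rewrite /row_free -addsmxE addsmx0 (eqP fq).
  by rewrite addn1 neq_ltn ltnS leqnn.
have [j pj] : exists j, p 0 j != 0 by apply/rV0Pn.
have full : row_full q^T by rewrite /row_full mxrank_tr.
pose s : {ffun 'I_k -> 'I_n.+1} := finfun (fullrankfun full).
have us : colsub s q \in unitmx.
  have := fullrowsub_unit full; rewrite -unitmx_tr.
  by rewrite (_ : colsub s q = (rowsub (fullrankfun full) q^T)^T) //;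
    apply/matrixP => a b; rewrite !mxE ffunE.
pose H (h : T -> K) : 'M[K]_k := \matrix_(a, b) h (inl (a, b)).
(* The prescribed block must be invertible and the prescribed coordinate nonzero for the base change
   [C] and the scalar [t] to be invertible. *)
have [h] : exists h : T -> K, Q h * (\det (H h) * h (inr tt)) != 0.
  apply: polyfun_mul_neq0 => //.
    apply: polyfunM; last exact: polyfun_coord.
    apply: polyfun_det => a b.
    by apply: (polyfun_ext _ (polyfun_coord K (inl (a, b) : T))) => h; rewrite mxE.
  exists (fun t => match t with inl ab => (ab.1 == ab.2)%:R | inr _ => 1 end).
  rewrite mulr1 (_ : H _ = 1%:M) ?det1 ?oner_eq0 //.
  by apply/matrixP => a b; rewrite !mxE.
rewrite !mulf_eq0 !negb_or => /and3P[Qh dh ht].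
pose C := H h *m invmx (colsub s q).
pose t := h (inr tt) / p 0 j.
have t0 : t != 0 by rewrite mulf_neq0 // invr_neq0.
have uC : C \in unitmx by rewrite unitmx_mul unitmx_inv us andbT unitmxE unitfE.
pose q' := C *m q; pose p' := t *: p.
pose u (z : I) : K := match z with inl i => p' 0 i | inr ai => q' ai.1 ai.2 end.
exists (s, j), u; split.
- rewrite (_ : _ \o _ = h) //; apply/funext => -[[a b]|[]] /=.
    rewrite [RHS](_ : _ = (C *m colsub s q) a b); last first.
      by rewrite /C mulmxKV // /H mxE.
    by rewrite /q' !mxE; apply: eq_bigr => l _; rewrite [colsub _ _ _ _]mxE.
  by rewrite mxE /t mulfVK.
- case=> [[]|[a i]]; rewrite /phi /=.
    by rewrite (homog_mevalZ _ _ (dhomog_is_dhomog F)) Fp mulr0.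
  have hF : dirder (row a q') (F : {mpoly K[n.+1]})^`M(i) \is (d - 2).-homog.
    apply: dirder_homog; apply: mderiv_homog.
    by rewrite -[(d - 2).+2]add2n subnKC //; exact: dhomog_is_dhomog.
  transitivity (dirder (row a q') (F : {mpoly K[n.+1]})^`M(i)).@[p' 0].
    by rewrite meval_dirder; apply: eq_bigr => l _; rewrite [row _ _ _ _]mxE.
  rewrite (homog_mevalZ _ _ hF) (_ : row a q' = \sum_l C a l *: row l q).
    rewrite dirder_suml linear_sum big1 ?mulr0 // => l _ /=.
    by rewrite mevalZ Hq mulr0.
  by rewrite row_mul mulmx_sum_row; apply: eq_bigr => l _; rewrite mxE.
apply: hessian_rank.
rewrite /row_free eqn_leq rank_leq_row /=.
apply: (leq_trans (eq_leq (esym (eqP fqp)))).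
rewrite mxrankS // -!addsmxE addsmxS //.
  by rewrite -[X in (X <= _)%MS](mulKmx uC) submxMl.
by rewrite eqmx_scale.
Qed.

End Hessian.

Lemma polyfun_restr (K : numFieldType) (J : finType) (N : nat)
    (p z : (J -> K) -> 'rV[K]_N) (F : {mpoly K[N]}) :
  (forall i, polyfun (fun u => p u 0 i)) -> (forall i, polyfun (fun u => z u 0 i)) ->
  forall k, polyfun (fun u => (restr (p u) (z u) F)`_k).
Proof.
move=> hp hz; elim/mpoly_ring_ind: F => [c|i|F G hF hG|F G hF hG] k.
- by apply: (polyfun_ext _ (polyfun_cst J ((c%:P)`_k))) => u; rewrite restrC.
- apply: (@polyfun_ext _ _ (fun u => p u 0 i *+ (k == 0)%N + z u 0 i * 'X`_k)).
    by move=> u; rewrite restrXU coefD coefC coefZ; case: eqP.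
  apply: polyfunD; last by apply: polyfunM; [exact: hz|exact: polyfun_cst].
  by case: (k == 0)%N; [exact: hp|exact: polyfun_cst].
- by apply: (polyfun_ext _ (polyfunD (hF k) (hG k))) => u; rewrite restrD coefD.
apply: (@polyfun_ext _ _ (fun u => \sum_(i < k.+1)
    (restr (p u) (z u) F)`_i * (restr (p u) (z u) G)`_(k - i))).
  by move=> u; rewrite restrM coefM.
by apply: polyfun_sum => i; apply: polyfunM; [exact: hF|exact: hG].
Qed.

(** * Finitely many lines through a point with functionals killing the partial derivatives *)

Section NonfreeLines.
Variables (K : numFieldType) (n d c : nat).
Implicit Types (p v w : 'rV[K]_n.+1) (z : 'M[K]_(c, n.+1)) (F G : {mpoly K[n.+1]}).
Implicit Types (l : 'M[K]_(c, d)).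

Let R := (unit + 'I_c * 'I_d + 'I_c * 'I_n.+1)%type.
Let line_cond (r : R) p z l F : K :=
  match r with
  | inl (inl _) => F.@[p 0]
  | inl (inr ik) => (restr p (row ik.1 z) F)`_(ik.2).+1
  | inr ij => \sum_k l ij.1 k * (restr p (row ij.1 z) F^`M(ij.2))`_k
  end.

(* The coefficient of [x_0 z_i z_j] enters the conditions of both lines [i] and
   [j]; all the others are attached to one line, so the pivots [kk i >= 2]
   make the conditions of distinct lines independent. *)
Lemma nonfree_lines_rank p z l (kk : 'I_c -> 'I_d) :
  row_free (col_mx p z) -> (forall i, (2 <= kk i)%N) -> (forall i, l i (kk i) != 0) ->
  functional_rank_ge (fun r (F : dhomog n.+1 K d) => line_cond r p z l F)
    (1 + c * d + c * n.-1).
Proof.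
move=> fpz kk2 l0; have cn : (1 + c <= n.+1)%N by rewrite -(eqP fpz) rank_leq_col.
have [g hg gE] := complete_frame cn fpz.
pose P := widen_ord cn (lshift c ord0).
pose ze (i : 'I_c) := widen_ord cn (rshift 1 i).
have gP : row P g = p by rewrite gE rowKu row_id.
have gze i : row (ze i) g = row i z by rewrite gE rowKd.
have zeP i : (P == ze i) = false by apply/negbTE; rewrite -val_eqE.
have zeE i j : (ze i == ze j) = (i == j) by rewrite -val_eqE /= eqn_add2l.
(* The directions [p] and [z_i] are left out: along the line, the derivative in direction [z_i] and,
   by Euler, the one in direction [p] are determined by the restriction of [F]. This leaves [n - 1]
   conditions per line. *)
pose B := {x : 'I_c * 'I_n.+1 | (x.2 != P) && (x.2 != ze x.1)}.
pose E := (unit + 'I_c * 'I_d + B)%type.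
exists E, (fun e r => match e, r with
  | inl e', inl r' => (e' == r')%:R
  | inr x, inr ij => ((val x).1 == ij.1)%:R * g (val x).2 ij.2
  | _, _ => 0
  end); split.
  rewrite !card_sum card_prod card_unit !card_ord card_sig leq_add2l.
  rewrite -sum1_card (eq_bigl (fun x : 'I_c * 'I_n.+1 => true && ((x.2 != P) &&
    (x.2 != ze x.1)))) //.
  rewrite -(pair_big_dep predT (fun (i : 'I_c) (b : 'I_n.+1) => (b != P) && (b !=
    ze i)) (fun _ _ => 1%N)) /=.
  rewrite -[X in (X * _)%N](card_ord c) -sum_nat_const; apply: leq_sum => i _.
  rewrite sum1dep_card (_ : [set b | _]%SET = ~: [set P; ze i]%SET); last first.
    by apply/setP => b; rewrite !inE negb_or.
  by rewrite cardsCs finset.setCK cards2 zeP card_ord /= subSS subn1.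
move=> ce hc.
pose val3 (x : B) F :=
  \sum_k l (val x).1 k * (restr p (row (val x).1 z) (dirder (row (val x).2 g) F))`_k.
have {}hc F : F \is d.-homog ->
    ce (inl (inl tt)) * F.@[p 0] +
    \sum_ik ce (inl (inr ik)) * (restr p (row ik.1 z) F)`_(ik.2).+1 +
    \sum_x ce (inr x) * val3 x F = 0.
  move=> hF; have := hc (DHomog hF); rewrite !big_sumType /= (big_pred1 tt) => [h|[]//].
  have E1 e : \sum_r match r with
      | inl r' => (e == r')%:R | inr _ => 0 end * line_cond r p z l F =
      line_cond (inl e) p z l F.
    rewrite big_sumType /= [X in _ + X]big1 ?addr0 => [|i _]; last by rewrite mul0r.
    rewrite (bigD1 e) //= eqxx mul1r big1 ?addr0 // => i ie.
    by rewrite eq_sym (negbTE ie) mul0r.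
  rewrite -[RHS]h E1; congr (_ + _ + _); first by apply: eq_bigr => ik _; rewrite E1.
  apply: eq_bigr => x _; congr (_ * _).
  rewrite big_sumType /= [X in _ = X + _]big1 ?add0r; last by move=> i _; rewrite mul0r.
  rewrite -(pair_bigA _ (fun a i => ((val x).1 == a)%:R * g (val x).2 i *
    \sum_k l a k * (restr p (row a z) F^`M(i))`_k)) /= (bigD1 (val x).1) //=.
  rewrite [X in _ = _ + X]big1 ?addr0 => [|a ax]; last first.
    by rewrite big1 // => i _; rewrite eq_sym (negbTE ax) !mul0r.
  rewrite eqxx /val3; under [RHS]eq_bigr do rewrite mul1r mulr_sumr.
  rewrite exchange_big; apply: eq_bigr => k _ /=.
  rewrite /dirder restr_sum coef_sum mulr_sumr; apply: eq_bigr => i _.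
  by rewrite restrZ coefZ mxE mulrCA.
have rd i e : restr p (row i z) (dualform g e) =
    ((P == e)%:R)%:P + (ze i == e)%:R *: 'X.
  by rewrite restr_linform -gP -gze !row_mul_dual.
have rdP i : restr p (row i z) (dualform g P) = 1.
  by rewrite rd eqxx [_ == P]eq_sym zeP scale0r addr0.
have rdz i j : restr p (row i z) (dualform g (ze j)) = (i == j)%:R *: 'X.
  by rewrite rd zeP zeE add0r.
(* For [b] different from [P] and [ze i], the form [x_b G_i] vanishes on all the lines, and its
   derivative along [b] restricts to ['X^(kk i)] on line [i], where [l i] sees it. On the other
   lines [G_i] vanishes with its first derivatives, since [2 <= kk i]. *)
pose G i := dualform g (ze i) ^+ kk i * dualform g P ^+ (d - (kk i).+1).
have rG i j : restr p (row j z) (G i) = (j == i)%:R *: 'X^(kk i).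
  rewrite restrM !restrX rdP rdz expr1n mulr1; case: (j == i).
    by rewrite !scale1r.
  by rewrite !scale0r expr0n (gtn_eqF (ltnW (kk2 i))).
have rDG i j v : j != i -> restr p (row j z) (dirder v (G i)) = 0.
  move=> ji; have r0 : restr p (row j z) (dualform g (ze i)) = 0.
    by rewrite rdz (negbTE ji) scale0r.
  rewrite /G -(subnKC (kk2 i)) exprD expr2 -!mulrA dirderM restrD !restrM r0.
  by rewrite !(mul0r, mulr0) addr0.
have hU i b : dualform g b * G i \is d.-homog.
  have := dualform_mul_homog g b (dhomogM (dualformX_homog g (ze i) (kk i))
    (dualformX_homog g P (d - (kk i).+1))).
  by rewrite -addSn subnKC.
clearbody G.
have rU i b j : (b != P) && (b != ze i) -> restr p (row j z) (dualform g b * G i) = 0.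
  move=> /andP[bP bz]; rewrite restrM rG rd.
  rewrite [P == b]eq_sym (negbTE bP) add0r; have [->|_] := eqVneq j i.
    by rewrite [ze i == b]eq_sym (negbTE bz) scale0r mul0r.
  by rewrite scale0r mulr0.
have c3 x : ce (inr x) = 0.
  case: x => [[i b] /= hb]; have := hc _ (hU i b).
  set x0 := exist _ _ _; have /andP[bP bz] := hb.
  have -> : (dualform g b * G i).@[p 0] = 0.
    by rewrite mevalM -gP meval_dualform // [P == b]eq_sym (negbTE bP) mul0r.
  rewrite mulr0 big1 => [|ik _]; last by rewrite rU // coef0 mulr0.
  rewrite !add0r (bigD1 x0) //= [X in _ + X]big1 ?addr0.
    rewrite /val3 /= (bigD1 (kk i)) //= big1.
      rewrite addr0 dirderM dirder_dualform // eqxx mul1r restrD restrM rd rG eqxx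
        scale1r.
      rewrite [P == b]eq_sym (negbTE bP) [ze i == b]eq_sym (negbTE bz) scale0r
        addr0 mul0r addr0.
      by rewrite coefXn eqxx mulr1 => /eqP;
        rewrite mulf_eq0 (negbTE (l0 i)) orbF => /eqP.
    move=> k ki; rewrite dirderM dirder_dualform // eqxx mul1r restrD restrM rd rG
      eqxx scale1r.
    rewrite [P == b]eq_sym (negbTE bP) [ze i == b]eq_sym (negbTE bz) scale0r addr0
      mul0r addr0.
    by rewrite coefXn (_ : (k == kk i :> nat) = false) ?mulr0 //; exact/negbTE.
  case=> [[i' b'] /= hb'] ne; rewrite /val3 /= big1 ?mulr0 // => k _.
  rewrite dirderM dirder_dualform // restrD !restrM restrC rG rd.
  rewrite [P == b]eq_sym (negbTE bP) add0r.
  have [ii|ii] := eqVneq i' i; last by rewrite rDG // scale0r !mulr0 addr0 coef0 mulr0.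
  have bb : b' != b.
    by apply: contra ne => /eqP e; apply/eqP/val_inj; rewrite /= ii e.
  by rewrite (negbTE bb) mul0r ii [ze i == b]eq_sym (negbTE bz) scale0r mul0r addr0
    coef0 mulr0.
(* The elimination is triangular: with the derivative conditions gone,
   [z_i ^ (k + 1) x_P ^ (d - k - 1)] isolates one coefficient on one line, and then [x_P ^ d] the
   value at [p]. *)
have c2 ik : ce (inl (inr ik)) = 0.
  case: ik => i k.
  have hV : dualform g (ze i) ^+ k.+1 * dualform g P ^+ (d - k.+1) \is d.-homog.
    have := dhomogM (dualformX_homog g (ze i) k.+1) (dualformX_homog g P (d - k.+1)).
    by rewrite subnKC.
  have := hc _ hV; rewrite [X in _ + X]big1 ?addr0 => [|x _]; last by rewrite c3 mul0r.
  rewrite exprS -mulrA mevalM -{1}gP meval_dualform // zeP mul0r mulr0 add0r mulrA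
    -exprS.
  have rV j : restr p (row j z) (dualform g (ze i) ^+ k.+1 * dualform g P ^+ (d - k.+1))
     = (j == i)%:R *: 'X^(k.+1).
    rewrite restrM !restrX rdP rdz expr1n mulr1; case: (j == i).
      by rewrite !scale1r.
    by rewrite !scale0r expr0n.
  rewrite (bigD1 (i, k)) //= rV eqxx scale1r coefXn eqxx mulr1 big1 ?addr0 // =>
    -[j k'] ne /=.
  rewrite rV coefZ coefXn eqSS; move: ne;
    rewrite xpair_eqE negb_and => /orP[/negbTE ->|].
    by rewrite mul0r mulr0.
  by rewrite -val_eqE => /negbTE /= ->; rewrite !mulr0.
have c1 : ce (inl (inl tt)) = 0.
  have := hc _ (dualformX_homog g P d).
  rewrite big1 ?addr0 => [|ik _]; last by rewrite c2 mul0r.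
  rewrite big1 ?addr0 => [|x _]; last by rewrite c3 mul0r.
  by rewrite rmorphXn /= -gP meval_dualform // eqxx expr1n mulr1.
by case=> [[[]|ik]|x].
Qed.

(* The parameters are [n + 1] coordinates for [p] and [n + 1 + d] for each pair
   [(z_i, l_i)], of which four per pair are prescribed through [Q]; the
   conditions number [1 + c d + c (n - 1)]. *)
Lemma thin_nonfree_lines : (n < 2 * c)%N ->
  thin (fun F : dhomog n.+1 K d => forall Q : ('I_c * 'I_4 -> K) -> K,
    polyfun Q -> (exists h, Q h != 0) ->
    exists (j a b : 'I_n.+1) (kk : 'I_c -> 'I_d) p z l,
    [/\ [/\ row_free (col_mx p z), forall i, (2 <= kk i)%N & forall i, l i (kk i) != 0],
        F.@[p 0] = 0,
        forall i, restr p (row i z) F = 0,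
        forall i j, \sum_k l i k * (restr p (row i z) F^`M(j))`_k = 0 &
        Q (fun t => [:: z t.1 j; z t.1 b; z t.1 a; l t.1 (kk t.1)]`_t.2) != 0]).
Proof.
move=> nc.
pose I := ('I_n.+1 + 'I_c * 'I_n.+1 + 'I_c * 'I_d)%type.
pose iota (x : 'I_n.+1 * 'I_n.+1 * 'I_n.+1 * {ffun 'I_c -> 'I_d}) (t : 'I_c * 'I_4)
  : I :=
  let: (i, s) := t in
  if s == 0 :> nat then inl (inr (i, x.1.1.1))
  else if s == 1 :> nat then inl (inr (i, x.1.2))
  else if s == 2 :> nat then inl (inr (i, x.1.1.2)) else inr (i, x.2 i).
pose up (u : I -> K) : 'rV[K]_n.+1 := \row_i u (inl (inl i)).
pose uz (u : I -> K) : 'M[K]_(c, n.+1) := \matrix_(i, j) u (inl (inr (i, j))).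
pose ul (u : I -> K) : 'M[K]_(c, d) := \matrix_(i, j) u (inr (i, j)).
apply: (@thin_incidence _ _ I _ _ R iota
  (fun r u (F : dhomog n.+1 K d) => line_cond r (up u) (uz u) (ul u) F)
  (1 + c * d + c * n.-1)).
- move=> [[t|[i k]]|[i j]] u a F G; rewrite /=.
  + by rewrite mevalD mevalZ.
  + by rewrite restrD restrZ coefD coefZ.
  rewrite mulr_sumr -big_split /=; apply: eq_bigr => k _.
  by rewrite mderivD mderivZ restrD restrZ coefD coefZ mulrDr mulrCA.
- have ppu i : polyfun (fun u => up u 0 i).
    by apply: (polyfun_ext _ (polyfun_coord K (inl (inl i) : I))) => u; rewrite mxE.
  have pzu i j : polyfun (fun u => (row i (uz u)) 0 j).
    by apply: (polyfun_ext _ (polyfun_coord K (inl (inr (i, j)) : I))) => u;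
      rewrite !mxE.
  have plu i j : polyfun (fun u => ul u i j).
    by apply: (polyfun_ext _ (polyfun_coord K (inr (i, j) : I))) => u; rewrite !mxE.
  move=> [[t|[i k]]|[i j]] F /=.
  + exact: polyfun_meval.
  + exact: (polyfun_restr _ ppu (pzu i)).
  by apply: polyfun_sum => k; apply: polyfunM => //;
    exact: (polyfun_restr _ ppu (pzu i)).
- rewrite !card_sum !card_prod !card_ord.
  (* For positive [n] this is [n < 2 c] after cancellation; for [n = 0], where [n.-1] truncates,
     [0 < c] is enough. *)
  case: n nc => [|n'] nc /=; nia.
move=> F hF Q pQ Qn0.
have [j [a [b [kk [p [z [l [[fpz kk2 l0] Fp Fz Fl Qu]]]]]]]] := hF Q pQ Qn0.
pose u (t : I) : K := match t with
  | inl (inl i) => p 0 i | inl (inr ij) => z ij.1 ij.2 | inr ik => l ik.1 ik.2 end.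
have eup : up u = p by apply/rowP => i; rewrite mxE.
have euz : uz u = z by apply/matrixP => i i'; rewrite mxE.
have eul : ul u = l by apply/matrixP => i i'; rewrite mxE.
exists (j, a, b, finfun kk), u; split.
- suff -> : u \o iota (j, a, b, finfun kk) =
      (fun t => [:: z t.1 j; z t.1 b; z t.1 a; l t.1 (kk t.1)]`_t.2) by [].
  apply/funext => -[i [[|[|[|[|s]]]] hs]] //=.
  by rewrite ffunE.
- rewrite eup euz eul => -[[t|[i k]]|[i i']] //=.
  by rewrite Fz coef0.
rewrite eup euz eul; exact: nonfree_lines_rank fpz kk2 l0.
Qed.

End NonfreeLines.

(** * Free lines *)

Section Line.
Variables (K : numFieldType) (n d : nat).
Hypothesis d0 : (0 < d)%N.
Implicit Types (p q v w z : 'rV[K]_n.+1) (F G : {mpoly K[n.+1]}).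
Implicit Types L : {vspace 'rV[K]_n.+1}.

Definition partials_span F L : Prop :=
  forall G, G \is d.-1.-homog ->
    exists a, forall q, q \in L -> (dirder a F).@[q 0] = G.@[q 0].

Lemma mem_line p z q : reflect (exists x y, q = x *: p + y *: z) (q \in <[p]> +
  <[z]>)%VS.
Proof.
apply: (iffP memv_addP) => [[_ /vlineP[x ->] [_ /vlineP[y ->] ->]]|[x [y ->]]].
  by exists x, y.
by exists (x *: p); rewrite ?memvZ ?memv_line //; exists (y *: z);
  rewrite ?memvZ ?memv_line.
Qed.

Lemma row_free2 p z : row_free (col_mx p z) <->
  (forall x y, x *: p + y *: z = 0 -> x = 0 /\ y = 0).
Proof.
rewrite -kermx_eq0; split=> [/eqP k0 x y e|h].
  have : (row_mx x%:M y%:M <= kermx (col_mx p z))%MS.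
    by apply/sub_kermxP; rewrite mul_row_col !mul_scalar_mx.
  rewrite k0 submx0 => /eqP; rewrite -(row_mx0 _ 1 1 1) => /eq_row_mx[/matrixP/(_ 0 0)].
  by rewrite !mxE eqxx mulr1n => -> /matrixP/(_ 0 0); rewrite !mxE eqxx mulr1n.
apply/eqP/row_matrixP => i; rewrite row0; set c := row i _.
have : c *m col_mx p z = 0 by rewrite /c -row_mul mulmx_ker row0.
rewrite -(hsubmxK c) mul_row_col (mx11_scalar (lsubmx c)) (mx11_scalar (rsubmx c)).
rewrite !mul_scalar_mx => /h[-> ->].
by apply/rowP => k; rewrite !mxE; case: split => ?; rewrite !mxE mul0rn.
Qed.

Lemma line_basis p z q : row_free (col_mx p z) -> q \in (<[p]> + <[z]>)%VS ->
  q != 0 -> exists2 q1, row_free (col_mx q q1) & (<[p]> + <[z]> = <[q]> + <[q1]>)%VS.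
Proof.
move=> /row_free2 h /mem_line[x [y ->]] q0.
have [x0|x0] := eqVneq x 0; last first.
  exists z.
    apply/row_free2 => a b; rewrite scalerDr -addrA !scalerA -scalerDl => /h[].
    move=> /eqP; rewrite mulf_eq0 (negbTE x0) orbF => /eqP ->.
    by rewrite mul0r add0r.
  apply/vspaceP => w; apply/mem_line/mem_line => -[a [b ->]]; last first.
    by exists (a * x), (a * y + b); rewrite scalerDl scalerDr !scalerA addrA.
  exists (a / x), (b - a / x * y).
  by rewrite scalerBl scalerDr !scalerA mulfVK // -addrA [X in _ = _ + X]addrC subrK.
have y0 : y != 0 by apply: contraNneq q0 => y0; rewrite x0 y0 !scale0r addr0.
rewrite x0 scale0r add0r; exists p.
  apply/row_free2 => a b; rewrite scalerA addrC => /h[-> /eqP].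
  by rewrite mulf_eq0 (negbTE y0) orbF => /eqP.
apply/vspaceP => w; apply/mem_line/mem_line => -[a [b ->]].
  by exists (b / y), a; rewrite scalerA mulfVK // addrC.
by exists b, (a * y); rewrite scalerA addrC.
Qed.

Lemma dual_pair p z : row_free (col_mx p z) ->
  exists cp cz : 'cV[K]_n.+1, forall x y,
    ((x *: p + y *: z) *m cp) 0 0 = x /\ ((x *: p + y *: z) *m cz) 0 0 = y.
Proof.
move=> fpz; have le2 : (1 + 1 <= n.+1)%N by rewrite -(eqP fpz) rank_leq_col.
have [g hg gE] := complete_frame le2 fpz.
have g1 := gE (lshift 1 ord0); have g2 := gE (rshift 1 ord0).
rewrite rowKu row_id in g1; rewrite rowKd row_id in g2.
exists (col (widen_ord le2 (lshift 1 ord0)) (invmx g)),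
  (col (widen_ord le2 (rshift 1 ord0)) (invmx g)) => x y.
rewrite !mulmxDl -!scalemxAl -g1 -g2; split; rewrite mxE [X in X + _]mxE.
  by rewrite [X in _ + X]mxE !row_mul_dual // eqxx -val_eqE /= mulr1 mulr0 addr0.
by rewrite [X in _ + X]mxE !row_mul_dual // eqxx -val_eqE /= mulr1 mulr0 add0r.
Qed.

(* Through [q] in [L] take coordinates [x], [y] on [L] with [q = (1 : 0)].  If
   [D_v F] vanishes at [q] then [D_v F = y r] on [L] and [x r = D_a F] for some
   [a]; the section through [v] is [x v - y a]. *)
Lemma partials_span_free F p z : F \is d.-homog -> row_free (col_mx p z) ->
  (forall q, q \in (<[p]> + <[z]>)%VS -> F.@[q 0] = 0) ->
  partials_span F (<[p]> + <[z]>)%VS -> free_line F (<[p]> + <[z]>)%VS.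
Proof.
move=> hF fpz F0 sp.
have diffE q v : differential F q v = (dirder v F).@[q 0].
  by rewrite meval_dirder; apply: eq_bigr => i _; rewrite mulrC.
split.
- have /row_free2 h := fpz.
  have -> : (<[p]> + <[z]> = <<[:: p; z]>>)%VS by rewrite span_cons span_seq1.
  apply/eqP; rewrite -[_ == _]/(free [:: p; z]) free_cons span_seq1 free_cons.
  rewrite nil_free span_nil memv0 andbT; apply/andP; split.
    apply/negP => /vlineP[k e]; have [|/eqP] := h 1 (- k).
    - by rewrite e scale1r scaleNr subrr.
    - by rewrite oner_eq0.
  apply/negP => /eqP z0; have [|_ /eqP] := h 0 1.
  - by rewrite z0 scaler0 addr0 scale0r.
  - by rewrite oner_eq0.
- by move=> q qL q0; split=> //; exact: F0.
- move=> q qL q0; have [q1 fq eL] := line_basis fpz qL q0.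
  have [cq [c1 hc]] := dual_pair fq.
  (* Smoothness at [q] follows by reaching the form [x ^ (d - 1)], whose value at [q] is 1. *)
  have [a ha] := sp _ (linformX_homog cq d.-1).
  exists a; rewrite diffE ha // rmorphXn /= meval_linform.
  have [e _] := hc 1 0; rewrite scale1r scale0r addr0 in e.
  by rewrite e expr1n oner_eq0.
move=> q v qL q0; rewrite diffE => Dv.
have [q1 fq eL] := line_basis fpz qL q0.
have [cq [c1 hc]] := dual_pair fq.
have hH : dirder v F \is d.-1.-homog by apply: dirder_homog; rewrite prednK.
pose r := restr q q1 (dirder v F).
(* This is [x] times the quotient of [D_v F] by [y]: the index shift is the division, possible
   because the coefficient of index 0 is the value of [D_v F] at [q], which is 0. *)
pose G := \sum_(k < d.-1) r`_k.+1 *: (linform cq ^+ (d.-1 - k) * linform c1 ^+ k).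
have hG : G \is d.-1.-homog.
  apply: rpred_sum => k _; apply: rpredZ.
  have := dhomogM (linformX_homog cq (d.-1 - k)) (linformX_homog c1 k).
  by rewrite subnK // ltnW.
have [a ha] := sp _ hG.
pose s w := (w *m cq) 0 0 *: v - (w *m c1) 0 0 *: a.
exists s; last first.
  have [e1 e2] := hc 1 0; rewrite scale1r scale0r addr0 in e1 e2.
  by rewrite /s e1 e2 scale1r scale0r subr0 subrr mem0v.
split.
- move=> w wL _; rewrite diffE /s dirderDl -scaleNr !dirderZl mevalD !mevalZ ha //.
  move: wL; rewrite eL => /mem_line[x [y ->]]; have [-> ->] := hc x y.
  rewrite (homog_meval_line _ _ _ _ hH) -/r big_ord_recl.
  rewrite /r coef0_restr Dv mul0r add0r linear_sum mulr_sumr mulr_sumr -big_split /=.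
  rewrite big1 // => k _; rewrite mevalZ rmorphM !rmorphXn /= !meval_linform.
  have [-> ->] := hc x y; rewrite -/r [bump _ _]/= /bump /= add1n.
  have -> : (d.-1 - k = (d.-1 - k.+1).+1)%N by rewrite subnSK.
  by rewrite !exprS; ring.
- move=> c w _ _ _.
  have E (e : 'cV[K]_n.+1) : ((c *: w) *m e) 0 0 = c * (w *m e) 0 0.
    by rewrite -scalemxAl mxE.
  by rewrite /s !E -!scalerA -scalerBr subrr mem0v.
move=> w0 _ _; exists 0%N, 1, (fun i => v 0 i *: linform cq - a 0 i *: linform c1).
split; first exact: dhomog1.
- by move=> i; rewrite rpredB // rpredZ // linform_homog.
- by rewrite meval1 oner_neq0.
move=> w _ _ _; rewrite meval1 invr1 scale1r (_ : \row__ _ = s w) ?subrr ?mem0v //.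
apply/rowP => i; rewrite mxE mevalB !mevalZ !meval_linform /s.
by move: ((w *m cq) 0 0) ((w *m c1) 0 0) => e1 e2; rewrite !mxE mulrC [X in _ - X]mulrC.
Qed.

(** The rows are the partial derivatives of [F] on the line, in the monomial basis of binary forms
    of degree [d - 1]; a column killed by this matrix is a functional killing all of them. *)
Definition partials_mx F p z : 'M[K]_(n.+1, d) :=
  \matrix_(j, k) (restr p z F^`M(j))`_k.

Lemma partials_mxE F p z a k :
  (restr p z (dirder a F))`_k = \sum_j a 0 j * (restr p z F^`M(j))`_k.
Proof.
by rewrite restr_sum coef_sum; apply: eq_bigr => j _; rewrite restrZ coefZ.
Qed.

Lemma partials_mx_span F p z : F \is d.-homog ->
  row_full (partials_mx F p z) -> partials_span F (<[p]> + <[z]>)%VS.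
Proof.
move=> hF full G hG.
have /submxP[a ha] := submx_full (\row_(k < d) (restr p z G)`_k) full.
exists a => _ /mem_line[x [y ->]].
have hD : dirder a F \is d.-1.-homog by apply: dirder_homog; rewrite prednK.
rewrite !(homog_meval_line _ _ _ _ hD) !(homog_meval_line _ _ _ _ hG).
apply: eq_bigr => k _; congr (_ * _); rewrite partials_mxE.
have kd : (k < d)%N by exact: leq_trans (ltn_ord k) (eq_leq (prednK d0)).
move/rowP: ha => /(_ (Ordinal kd)); rewrite !mxE /= => ->.
by apply: eq_bigr => j _; rewrite mxE.
Qed.

(** With the converse just above, this makes fullness of the matrix independent of the two points
    chosen on the line. *)
Lemma partials_span_mx F p z : row_free (col_mx p z) ->
  partials_span F (<[p]> + <[z]>)%VS -> row_full (partials_mx F p z).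
Proof.
move=> fpz sp; apply: contraT => /not_row_full[l l0 Al].
have [k lk] : exists k, l k 0 != 0.
  apply: contrapT => /forallNP h; case/eqP: l0; apply/colP => k.
  by have /negP/negPn/eqP := h k; rewrite mxE.
have [cp [cz hc]] := dual_pair fpz.
have hG : linform cp ^+ (d.-1 - k) * linform cz ^+ k \is d.-1.-homog.
  have := dhomogM (linformX_homog cp (d.-1 - k)) (linformX_homog cz k).
  by rewrite subnK // -ltnS prednK.
have [a ha] := sp _ hG.
have e : restr p z (dirder a F) = 'X^k.
  apply: poly_eq_nonzero => t _; rewrite horner_restr ha; last first.
    by apply/mem_line; exists 1, t; rewrite scale1r.
  rewrite rmorphM !rmorphXn /= !meval_linform; have [e1 e2] := hc 1 t.
  by rewrite scale1r in e1 e2; rewrite e1 e2 expr1n mul1r hornerXn.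
case/eqP: lk; transitivity ((a *m (partials_mx F p z *m l)) 0 0); last first.
  by rewrite Al mulmx0 mxE.
rewrite mulmxA mxE (bigD1 k) //= big1 ?addr0.
  rewrite mxE (eq_bigr (fun j => a 0 j * (restr p z F^`M(j))`_k)) => [|j _];
    last by rewrite mxE.
  by rewrite -partials_mxE e coefXn eqxx mul1r.
move=> i ik; rewrite mxE (eq_bigr (fun j => a 0 j * (restr p z F^`M(j))`_i)) => [|j
  _]; last by rewrite mxE.
by rewrite -partials_mxE e coefXn (_ : (i == k :> nat) = false) ?mul0r //; exact/negbTE.
Qed.

End Line.

(** * Irreducible sets and hyperplanes *)

Section Irreducible.
Variables (K : numFieldType) (n : nat).
Implicit Types (Y : set 'rV[K]_n) (y : 'rV[K]_n) (c : 'cV[K]_n).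

Lemma vpolyfun_entry (f : ('I_n -> K) -> K) : polyfun f ->
  vpolyfun (fun y : 'rV[K]_n => f (y 0)).
Proof.
move=> pf; apply: (vpolyfun_comp (g := fun j y => y 0 j) pf) => j.
have lin : scalar (fun y : 'rV[K]_n => y 0 j) by move=> a u v; rewrite !mxE.
exact: (vpolyfun_linear (HB.pack (fun y : 'rV[K]_n => y 0 j)
  (GRing.isLinear.Build _ _ _ _ _ lin) : {scalar 'rV[K]_n})).
Qed.

(** An irreducible set covered by finitely many hyperplanes lies in one of them; so finitely many
    nonvanishing conditions, each satisfied somewhere on [Y], are satisfied at one common point. *)
Lemma irreducible_avoid Y (s : seq 'cV[K]_n) : zirreducible Y ->
  (forall c, c \in s -> exists2 y, Y y & y *m c != 0) ->
  exists2 y, Y y & forall c, c \in s -> y *m c != 0.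
Proof.
move=> [[I hI eY] [y0 Yy0] irr] hs.
have Yn0 y : Y y -> y != 0 by rewrite eY => -[].
pose H (s : seq 'cV[K]_n) := [set y : 'rV[K]_n | y != 0 /\ has (fun c => y *m c ==
  0) s].
have mx11_eq0 (A : 'M[K]_1) : (A == 0) = (A 0 0 == 0).
  apply/eqP/eqP => [->|A0]; first by rewrite mxE.
  by apply/matrixP => i j; rewrite !ord1 A0 mxE.
have cH t : zclosed (H t).
  pose g (_ : unit) (y : 'rV[K]_n) := \prod_(c <- t) (y *m c) 0 0.
  have pg x : vpolyfun (g x).
    have -> : g x = fun y => \prod_(c <- t) \sum_i y 0 i * c i 0.
      by apply/funext => y; apply: eq_bigr => c _; rewrite mxE.
    apply: (vpolyfun_entry (f := fun u => \prod_(c <- t) \sum_i u i * c i 0)).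
    apply: polyfun_prod => c; apply: polyfun_sum => i.
    by apply: polyfunM; [exact: polyfun_coord|exact: polyfun_cst].
  have gE x a y : a != 0 -> g x (a *: y) = 0 <-> has (fun c => y *m c == 0) t.
    move=> a0; rewrite (eq_has (a2 := fun c => ((a *: y) *m c) 0 0 == 0)); last first.
      by move=> c; rewrite mx11_eq0 -scalemxAl [in RHS]mxE mulf_eq0 (negbTE a0).
    by rewrite -(prodf_seq_eq0 t xpredT); split=> /eqP.
  rewrite (_ : H t = [set y | y != 0 /\ forall x a, a != 0 -> g x (a *: y) = 0]).
    exact: zclosed_scaled_zeros.
  apply/seteqP; split=> y [y1 hy]; split=> //.
    by move=> x a a0; apply/(gE x a y a0).
  exact/(gE tt 1 y (oner_neq0 _))/hy/oner_neq0.
have key t : Y `<=` H t -> exists2 c, c \in t & Y `<=` H [:: c].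
  elim: t => [|c t IH] YH; first by have [] := YH _ Yy0.
  have [] := irr (H [:: c]) (H t) (cH _) (cH _).
  - by move=> y /YH[y1 /= /orP[yc|yt]]; [left|right]; split=> //=; rewrite yc.
  - by move=> h; exists c; rewrite ?mem_head.
  by move=> /IH[e et h]; exists e; rewrite // in_cons et orbT.
apply: contrapT => none.
have [|c cs YH] := key s.
  move=> y Yy; split; first exact: Yn0.
  apply: contraT => /hasPn h; exfalso; apply: none; exists y => // c /h.
have [y Yy /negP] := hs c cs; apply.
by have [_ /=] := YH y Yy; rewrite orbF.
Qed.

End Irreducible.

(** * Openness of freeness along the curve *)

Section GeneralLine.
Variables (K : numFieldType) (n d : nat).
Hypothesis d0 : (0 < d)%N.
Implicit Types (p : 'rV[K]_n.+1) (B : 'M[K]_(n, n.+1)) (Y : set 'rV[K]_n).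

(** A maximal minor of [partials_mx] that is nonzero at [y0] is polynomial in [y]; its nonvanishing
    defines the open set. *)
Lemma general_line_free (F : dhomog n.+1 K d) p B Y (y0 : 'rV[K]_n) :
  (col_mx p B : 'M[K]_n.+1) \in unitmx -> zclosed Y ->
  cone_over p B Y `<=` hypersurface F -> Y y0 ->
  row_full (partials_mx d F p (y0 *m B)) ->
  for_general Y (fun y => free_line F (join_line p B y)).
Proof.
move=> uB [I hI eY] cone Yy0 full0.
have Yn0 y : Y y -> y != 0 by rewrite eY => -[].
pose f := fullrankfun full0.
pose g (_ : unit) (y : 'rV[K]_n) := \det (rowsub f (partials_mx d F p (y *m B))).
have pg x : vpolyfun (g x).
  pose h (u : 'I_n -> K) := \det (rowsub f (partials_mx d F p ((\row_i u i) *m B))).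
  have -> : g x = fun y => h (y 0).
    apply/funext => y; rewrite /g /h (_ : \row_i y 0 i = y) //.
    by apply/rowP => i; rewrite mxE.
  apply: (vpolyfun_entry (f := h)); apply: polyfun_det => a k.
  apply: (@polyfun_ext _ _ (fun u : 'I_n -> K =>
    (restr p ((\row_i u i) *m B) (F : {mpoly K[n.+1]})^`M(f a))`_k)).
    by move=> u; rewrite !mxE.
  apply: (@polyfun_restr _ _ _ (fun=> p) (fun u : 'I_n -> K => (\row_i u i) *m B)) => i.
    exact: polyfun_cst.
  apply: (@polyfun_ext _ _ (fun u : 'I_n -> K => \sum_j u j * B j i)).
    by move=> u; rewrite mxE; apply: eq_bigr => j _; rewrite mxE.
  by apply: polyfun_sum => j; apply: polyfunM;
    [exact: polyfun_coord|exact: polyfun_cst].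
pose Z := [set y : 'rV[K]_n | y != 0 /\ forall x a, a != 0 -> g x (a *: y) = 0].
exists (proj_space 'rV[K]_n `\` Z); split.
- by exists Z => //; exact: zclosed_scaled_zeros.
- exists y0; split=> //; split; first exact: Yn0.
  move=> [_ /(_ tt 1 (oner_neq0 _))]; rewrite scale1r => /eqP.
  by have := fullrowsub_unit full0; rewrite unitmxE unitfE => /negbTE ->.
move=> y Yy [_ nZ].
(* Outside [Z] the minor is nonzero at some multiple of [y], which spans the same line with [p]. *)
have [a a0 ga] : exists2 a, a != 0 & g tt (a *: y) != 0.
  apply: contrapT => h; apply: nZ; split; first exact: Yn0.
  move=> [] a a0; apply/eqP; apply: contraT => ga; exfalso; apply: h.
  by exists a.
have eJ : join_line p B y = (<[p]> + <[(a *: y) *m B]>)%VS.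
  apply/vspaceP => w; apply/mem_line/mem_line => -[b [c ->]].
    by exists b, (c / a); rewrite -scalemxAl scalerA mulfVK.
  by exists b, (c * a); rewrite -scalemxAl scalerA.
rewrite eJ; have hF : (F : {mpoly K[n.+1]}) \is d.-homog by exact: dhomog_is_dhomog.
apply: (partials_span_free d0 hF).
- by apply: row_free_join => //; rewrite scaler_eq0 negb_or a0 Yn0.
- move=> q; rewrite -eJ => qJ; have [->|q0] := eqVneq q 0.
    by rewrite -(scale0r 0) (homog_mevalZ _ _ hF) expr0n gtn_eqF ?mul0r.
  have [] : hypersurface F q by apply: cone; split=> //; exists y.
  by [].
apply: (partials_mx_span d0 hF); rewrite -sub1mx.
have : row_full (rowsub f (partials_mx d F p ((a *: y) *m B))).
  by rewrite row_full_unit unitmxE unitfE.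
rewrite -sub1mx => /submx_trans; apply; exact: rowsub_sub.
Qed.

End GeneralLine.

(** * Cones of non-free lines *)

Definition update (T : eqType) (A : Type) (x : T -> A) (t : T) (v : A) : T -> A :=
  fun s => if s == t then v else x s.

Lemma polyfun_update (K : numFieldType) (T : finType) (Q : (T -> K) -> K) x t :
  polyfun Q -> Q x != 0 ->
  exists2 q : {poly K}, q != 0 & forall v, Q (update x t v) = q.[v].
Proof.
move=> pQ Qx.
have [q hq] := polyfun_horner (fun s => if s == t then 'X else (x s)%:P) pQ.
have {}hq v : Q (update x t v) = q.[v].
  by rewrite -hq; congr Q; apply/funext => s; rewrite /update; case: eqP => _;
    rewrite hornerE.
exists q => //; apply: contraNneq Qx => q0.
have := hq (x t); rewrite q0 horner0 => <-; apply/eqP; congr Q.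
by apply/funext => s; rewrite /update; case: eqP => [->|].
Qed.

Section Hessian.
Variables (K : numFieldType) (n : nat).
Implicit Types (F : {mpoly K[n.+1]}) (p v z : 'rV[K]_n.+1).

Definition hessian F p : 'M[K]_n.+1 := \matrix_(i, j) (F^`M(j)^`M(i)).@[p 0].

Lemma mul_hessian F p v j : (v *m hessian F p) 0 j = (dirder v F^`M(j)).@[p 0].
Proof. by rewrite meval_dirder mxE; apply: eq_bigr => i _; rewrite mxE. Qed.

Lemma mul_hessian_self d F p j : F \is d.+1.-homog ->
  (p *m hessian F p) 0 j = d%:R * (F^`M(j)).@[p 0].
Proof. by move=> hF; rewrite mul_hessian (euler_homog _ (mderiv_homog j hF)). Qed.

(* A functional on forms of degree [d - 1] supported on the two leading
   coefficients sees only the 2-jet of [F] at [p]. *)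
Lemma jet_functional_kernel d F p z (l : 'cV[K]_d) : F \is d.-homog ->
  (exists i, (F^`M(i)).@[p 0] != 0) -> l != 0 -> partials_mx d F p z *m l = 0 ->
  (forall k : 'I_d, (2 <= k)%N -> l k 0 = 0) ->
  (1 < d)%N /\ (z <= p + kermx (hessian F p))%MS.
Proof.
move=> hF [i0 sm] l0 Nl l2.
have E j : \sum_(k < d) (restr p z F^`M(j))`_k * l k 0 = 0.
  have /colP/(_ j) := Nl; rewrite !mxE => h; rewrite -[RHS]h.
  by apply: eq_bigr => k _; rewrite mxE.
case: d l hF l0 {Nl} l2 E => [|[|d]] l hF l0 l2 E.
- by case/eqP: l0; apply/colP => -[].
- case/eqP: l0; apply/colP => k; rewrite ord1 mxE; apply/eqP.
  have := E i0; rewrite big_ord1 coef0_restr => /eqP.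
  by rewrite mulf_eq0 (negbTE sm).
split=> //.
have {}E j : (F^`M(j)).@[p 0] * l ord0 0 +
    (z *m hessian F p) 0 j * l (lift ord0 ord0) 0 = 0.
  have := E j; rewrite !big_ord_recl coef0_restr coef1_restr -mul_hessian.
  by rewrite big1 ?addr0 // => k _; rewrite [l _ _]l2 ?mulr0.
have l1 : l (lift ord0 ord0) 0 != 0.
  apply: contraNneq l0 => l1; apply/eqP/colP => k; rewrite mxE.
  have [k2|] := leqP 2 k; first exact: l2.
  case: k => -[|[|k]] //= hk _; last by rewrite -[RHS]l1; congr (l _ 0); exact: val_inj.
  have /eqP := E i0; rewrite l1 mulr0 addr0 mulf_eq0 (negbTE sm) /= => /eqP h.
  by rewrite -[RHS]h; congr (l _ 0); exact: val_inj.
(* By Euler, the gradient at [p] is [p *m hessian F p] divided by the degree minus one, so the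
   relation [E] says that [w] lies in the kernel. *)
pose w := l (lift ord0 ord0) 0 *: z + (l ord0 0 / d.+1%:R) *: p.
have wk : (w <= kermx (hessian F p))%MS.
  apply/sub_kermxP/rowP => j;
    rewrite mulmxDl -!scalemxAl [RHS]mxE mxE [X in X + _]mxE [X in _ + X]mxE.
  rewrite (mul_hessian_self _ _ hF) -mulrA mulKf ?pnatr_eq0 // -[RHS](E j).
  by rewrite addrC mulrC [X in _ + X]mulrC.
have -> : z = (l (lift ord0 ord0) 0)^-1 *: (w - (l ord0 0 / d.+1%:R) *: p).
  by rewrite /w addrK scalerA mulVf // scale1r.
apply: scalemx_sub; apply: addmx_sub.
  exact: submx_trans wk (addsmxSr _ _).
by rewrite eqmx_opp; apply: scalemx_sub; exact: addsmxSl.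
Qed.

End Hessian.

(** * A cone none of whose lines has spanning partial derivatives *)

Section ConeLines.
Variables (K : numClosedFieldType) (n d : nat).
Hypothesis d0 : (0 < d)%N.
Variables (F : {mpoly K[n.+1]}) (p : 'rV[K]_n.+1) (B : 'M[K]_(n, n.+1)).
Variable Y : set 'rV[K]_n.
Hypotheses (hF : F \is d.-homog) (uB : (col_mx p B : 'M[K]_n.+1) \in unitmx).
Hypotheses (irrY : zirreducible Y) (sm : exists i, (F^`M(i)).@[p 0] != 0).
Hypothesis nonfree : forall y, Y y -> ~~ row_full (partials_mx d F p (y *m B)).

Let Kp := (p + kermx (hessian F p))%MS.

Lemma irreducible_neq0 y : Y y -> y != 0.
Proof. by case: irrY => -[I _ ->] _ _ []. Qed.

Lemma apex_neq0 : p != 0.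
Proof.
apply/eqP => p0; have := uB; rewrite -row_free_unit -kermx_eq0 => /eqP k0.
have : (row_mx 1%:M 0 : 'rV_(1 + n)) *m (col_mx p B : 'M[K]_(1 + n, n.+1)) = 0.
  by rewrite mul_row_col mul1mx mul0mx addr0.
move/sub_kermxP; rewrite k0 submx0 -(row_mx0 _ 1 1 n) => /eqP h.
have [/matrixP/(_ 0 0)] := @eq_row_mx _ 1 1 n _ _ _ _ h.
by rewrite !mxE eqxx => /eqP; rewrite oner_eq0.
Qed.

(** When [p 0 j != 0], [y *m B' j] is the representative of [y *m B] modulo [p] with coordinate [j]
    equal to 0. Hence coordinate [j] of [s *: (y *m B' j) + u *: p] is governed by [u] alone. *)
Let B' j : 'M[K]_(n, n.+1) := B - (p 0 j)^-1 *: (col j B *m p).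

Lemma proj_coordE j (y : 'rV[K]_n) e : (y *m B' j) 0 e =
  (y *m B) 0 e - (y *m B) 0 j / p 0 j * p 0 e.
Proof.
rewrite mulmxBr -scalemxAr colE !mulmxA -colE mxE [X in _ + X]mxE [X in - X]mxE.
by rewrite [(_ *m p) _ _]mxE big_ord1 [col _ _ _ _]mxE mulrA [_^-1 * _]mulrC.
Qed.

Lemma projE j (y : 'rV[K]_n) : y *m B' j = y *m B - ((y *m B) 0 j / p 0 j) *: p.
Proof. by apply/rowP => e; rewrite proj_coordE; move: (y *m B) => w; rewrite !mxE. Qed.

Lemma proj_eq0 j (y : 'rV[K]_n) : y *m B' j = 0 -> y = 0.
Proof.
rewrite projE => /eqP; rewrite subr_eq0 => /eqP e; apply/eqP; apply: contraT => y0.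
have /row_free2 h := row_free_join uB y0.
have [] := h (- ((y *m B) 0 j / p 0 j)) 1; first by rewrite scale1r scaleNr -e addNr.
by move=> _ /eqP; rewrite oner_eq0.
Qed.

(* The pivot exists because the 2-jet does not suffice: [y *m B] is not in [Kp]. *)
Lemma nonfree_functional y s u : Y y -> ~~ (y *m B <= Kp)%MS -> s != 0 ->
  exists (k : 'I_d) (l : 'cV[K]_d), [/\ (2 <= k)%N, l k 0 != 0 &
    partials_mx d F p (s *: (y *m B) + u *: p) *m l = 0].
Proof.
move=> Yy yK s0; set z := _ + _; have y0 := irreducible_neq0 Yy.
have fz : row_free (col_mx p z).
  apply/row_free2 => a b; rewrite /z scalerDr addrCA !scalerA -scalerDl addrC => e.
  have /row_free2 h := row_free_join uB y0; have [h1 /eqP] := h _ _ e.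
  rewrite mulf_eq0 (negbTE s0) orbF => /eqP b0.
  by move: h1; rewrite b0 mul0r addr0.
have eL : (<[p]> + <[z]> = <[p]> + <[y *m B]>)%VS.
  apply/vspaceP => w; apply/mem_line/mem_line => -[a [b ->]].
    exists (a + b * u), (b * s).
    by rewrite /z scalerDr !scalerA scalerDl -addrA [X in _ = _ + X]addrC.
  exists (a - b / s * u), (b / s).
  by rewrite /z scalerDr !scalerA mulfVK // scalerBl [X in _ = _ + X]addrC addrA subrK.
have : ~~ row_full (partials_mx d F p z).
  apply: contra (nonfree Yy) => /(partials_mx_span d0 hF); rewrite eL.
  exact: partials_span_mx (row_free_join uB y0).
move=> /not_row_full[l l0 Nl].
have [[k k2 lk]|none] := EM (exists2 k : 'I_d, (2 <= k)%N & l k 0 != 0).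
  by exists k, l.
have [] := jet_functional_kernel hF sm l0 Nl.
  move=> k k2; apply/eqP; apply: contraT => lk; exfalso; apply: none.
  by exists k.
move=> _ zK; case/negP: yK.
have -> : y *m B = s^-1 *: (z - u *: p).
  by rewrite /z addrK scalerA mulVf // scale1r.
apply: scalemx_sub; apply: addmx_sub => //.
by rewrite eqmx_opp; apply: scalemx_sub; exact: addsmxSl.
Qed.

(* Replacing [z] by [s z + u p] makes two of its coordinates arbitrary, and a
   third takes infinitely many values since [Y] is not a point; [l] can be
   rescaled.  So four coordinates can be moved off the zeros of [Q], one after
   the other. *)
Lemma cone_point (T : finType) (t : 'I_4 -> T) (Q : (T -> K) -> K) (x : T -> K)
    (m : nat) (M : 'M[K]_(m, n)) (j a b : 'I_n.+1) :
  injective t -> polyfun Q -> Q x != 0 -> p 0 j != 0 ->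
  (exists2 y, Y y & ~~ (y <= M)%MS) -> (exists2 y, Y y & ~~ (y *m B <= Kp)%MS) ->
  (exists2 y, Y y & (y *m B' j) 0 b != 0) ->
  (forall e1 e2, e1 != 0 -> exists2 y, Y y & e1 * (y *m B' j) 0 a + e2 * (y *m B'
    j) 0 b != 0) ->
  exists (x' : T -> K) y (z : 'rV[K]_n.+1) (l : 'cV[K]_d) (k : 'I_d),
  [/\ [/\ Y y, ~~ (y <= M)%MS &
      exists s u, s != 0 /\ z = s *: (y *m B) + u *: p],
    [/\ (2 <= k)%N, l k 0 != 0 & partials_mx d F p z *m l = 0],
    Q x' != 0,
    forall i, x' (t i) = [:: z 0 j; z 0 b; z 0 a; l k 0]`_i &
    forall s, (forall i, s != t i) -> x' s = x s].
Proof.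
move=> tI pQ Qx pj [ym Yym ymM] [yk Yyk ykK] [yb Yyb ybb] ratio.
pose t0 := t ord0; pose t1 := t (inord 1); pose t2 := t (inord 2);
  pose t3 := t (inord 3).
have [q0 q00 hq0] := polyfun_update t0 pQ Qx.
have [cu hcu] := poly_nonroot q00.
pose u : K := cu%:R / p 0 j; pose x0 := update x t0 (u * p 0 j).
have Qx0 : Q x0 != 0 by rewrite hq0 mulfVK.
have [q1 q10 hq1] := polyfun_update t1 pQ Qx0.
(* The extra factor makes [s'] nonzero, hence also [s], so that [z] is not a multiple of [p]. *)
have [cs] : exists c : nat, (q1 * ('X - (u * p 0 b)%:P)).[c%:R] != 0.
  by apply: poly_nonroot; rewrite mulf_neq0 // polyXsubC_eq0.
rewrite hornerM mulf_eq0 negb_or hornerXsubC => /andP[hcs s'0].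
set s' := _ - _ in s'0; pose x1 := update x0 t1 cs%:R.
have Qx1 : Q x1 != 0 by rewrite hq1.
have [q2 q20 hq2] := polyfun_update t2 pQ Qx1.
have [rs q2E] := closed_field_poly_normal q2.
have sub_col k (A : 'M[K]_(k, n)) (y : 'rV[K]_n) : ~~ (y <= A)%MS ->
    exists2 c : 'cV[K]_n, y *m c != 0 & forall w : 'rV[K]_n, w *m c != 0 -> ~~ (w
      <= A)%MS.
  rewrite submxE => yA;
    have [e he] : exists e, (y *m cokermx A) 0 e != 0 by apply/rV0Pn.
  exists (col e (cokermx A)).
    by apply: contraNneq he; rewrite colE mulmxA -colE => /matrixP/(_ 0 0);
      rewrite !mxE => ->.
  move=> w; apply: contraNN; rewrite submxE => /eqP wA.
  by rewrite colE mulmxA wA mul0mx.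
have [cM hcM cMP] := sub_col _ _ ym ymM.
have [cK hcK cKP] : exists2 c : 'cV[K]_n, yk *m c != 0 &
    forall w : 'rV[K]_n, w *m c != 0 -> ~~ (w *m B <= Kp)%MS.
  move: ykK; rewrite submxE => yA.
  have [e he] : exists e, (yk *m B *m cokermx Kp) 0 e != 0 by apply/rV0Pn.
  exists (B *m col e (cokermx Kp)).
    by apply: contraNneq he; rewrite mulmxA colE mulmxA -colE => /matrixP/(_ 0 0);
      rewrite !mxE => ->.
  move=> w; apply: contraNN; rewrite submxE => /eqP wA.
  by rewrite mulmxA colE mulmxA wA mul0mx.
pose ca := col a (B' j); pose cb := col b (B' j).
have entry y e : (y *m col e (B' j)) 0 0 = (y *m B' j) 0 e.
  by rewrite colE mulmxA -colE mxE.
have entry_neq0 (A : 'M[K]_1) : (A != 0) = (A 0 0 != 0).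
  congr (~~ _); apply/eqP/eqP => [->|A0]; first by rewrite mxE.
  by apply/matrixP => i i'; rewrite !ord1 A0 mxE.
(* With [u] and [s'] fixed, coordinate [a] of [z] depends only on [y], and it equals [r] exactly
   when [y] lies on the hyperplane [cr r]. Avoiding the roots of [q2] thus means avoiding finitely
   many hyperplanes. *)
pose cr r := s' *: ca + (u * p 0 a - r) *: cb.
have crE y r : (y *m cr r) 0 0 =
    s' * (y *m B' j) 0 a + (u * p 0 a - r) * (y *m B' j) 0 b.
  by rewrite mulmxDr -!scalemxAr mxE [X in X + _]mxE [X in _ + X]mxE !entry.
have [|y Yy hy] := irreducible_avoid (s := [:: cM, cK, cb & [seq cr r | r <- rs]]) irrY.
  move=> c; rewrite !inE => /or4P[/eqP->|/eqP->|/eqP->|/mapP[r _ ->]].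
  - by exists ym.
  - by exists yk.
  - by exists yb => //; rewrite entry_neq0 entry.
  have [y Yy h] := ratio s' (u * p 0 a - r) s'0.
  by exists y => //; rewrite entry_neq0 crE.
have yM : ~~ (y <= M)%MS by apply/cMP/hy; rewrite inE eqxx.
have yK : ~~ (y *m B <= Kp)%MS by apply/cKP/hy; rewrite !inE eqxx orbT.
have yb0 : (y *m B' j) 0 b != 0.
  by rewrite -entry -entry_neq0; apply: hy; rewrite !inE eqxx !orbT.
pose s := s' / (y *m B' j) 0 b.
have s0 : s != 0 by rewrite mulf_neq0 // invr_neq0.
pose z := s *: (y *m B' j) + u *: p.
have zE : z = s *: (y *m B) + (u - s * ((y *m B) 0 j / p 0 j)) *: p.
  by rewrite /z projE scalerBr scalerBl scalerA -addrA [X in _ + X]addrC.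
have ze e : z 0 e = s * (y *m B' j) 0 e + u * p 0 e.
  by rewrite /z mxE [X in X + _]mxE [X in _ + X]mxE.
have zj : z 0 j = u * p 0 j.
  by rewrite ze proj_coordE mulfVK // subrr mulr0 add0r.
have zb : z 0 b = cs%:R by rewrite ze mulfVK // subrK.
have q2z : q2.[z 0 a] != 0.
  rewrite q2E hornerZ horner_prod mulf_neq0 ?lead_coef_eq0 //.
  rewrite prodf_seq_neq0; apply/allP => r rrs; apply/implyP => _.
  rewrite hornerXsubC; have hr : cr r \in [:: cM, cK, cb & [seq cr r | r <- rs]].
    by rewrite !inE map_f ?orbT.
  apply: contraNneq (hy _ hr) => zr; rewrite -[_ == 0]negbK entry_neq0 negbK crE.
  have -> : s' = s * (y *m B' j) 0 b by rewrite mulfVK.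
  rewrite (_ : _ + _ = (y *m B' j) 0 b * (z 0 a - r)); last first.
    by rewrite ze; ring.
  by rewrite zr mulr0.
pose x2 := update x1 t2 (z 0 a).
have Qx2 : Q x2 != 0 by rewrite hq2.
have [k [l [k2 lk Nl]]] := nonfree_functional (u - s * ((y *m B) 0 j / p 0 j)) Yy yK s0.
rewrite -zE in Nl.
have [q3 q30 hq3] := polyfun_update t3 pQ Qx2.
have [v v0 q3v] := poly_nonroot_neq0 q30.
exists (update x2 t3 v), y, z, ((v / l k 0) *: l), k; split.
- by split=> //; exists s, (u - s * ((y *m B) 0 j / p 0 j)).
- split=> //; first by rewrite mxE mulfVK.
  by rewrite -scalemxAr Nl scaler0.
- by rewrite hq3.
- have e0 i j' : (t i == t j') = (i == j' :> nat) by rewrite (inj_eq tI).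
  move=> i; rewrite /update /x2 /x1 /x0 /update /t0 /t1 /t2 /t3 !e0 !inordK //.
  by case: i => -[|[|[|[|i]]]] hi //=; rewrite ?zj ?zb // mxE mulfVK.
move=> w hw; rewrite /update /x2 /x1 /x0 /update.
by rewrite !(negbTE (hw _)).
Qed.

Lemma independent_points (c : nat) :
  (forall i (M : 'M[K]_(i, n)), (i < c)%N -> exists2 y, Y y & ~~ (y <= M)%MS) ->
  exists2 M : 'M[K]_(c, n), row_free M & forall k, Y (row k M).
Proof.
move=> h; suff [ys fM YM] : exists2 ys : nat -> 'rV[K]_n,
    row_free (\matrix_(e < c) ys e) & forall e, (e < c)%N -> Y (ys e).
  by exists (\matrix_(e < c) ys e) => // k; rewrite rowK; apply: YM.
elim: c h => [|c IH] h.
  by exists (fun=> 0) => //; rewrite /row_free flatmx0 mxrank0.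
have [|ys fM YM] := IH; first by move=> i M ic; apply: h; exact: ltnW.
have [y Yy yM] := h _ (\matrix_(e < c) ys e) (ltnSn c).
have eM : \matrix_(e < c) update ys c y e = \matrix_(e < c) ys e.
  by apply/matrixP => i j; rewrite !mxE /update (ltn_eqF (ltn_ord i)).
exists (update ys c y).
  by apply: row_free_next; rewrite eM // /update eqxx.
by move=> e; rewrite /update ltnS leq_eqVlt; case: eqP => //= _; exact: YM.
Qed.

Hypothesis cone0 : forall y, Y y -> forall q, q \in (<[p]> + <[y *m B]>)%VS ->
  F.@[q 0] = 0.

Lemma cone_apex : F.@[p 0] = 0.
Proof.
case: (irrY) => _ [y Yy] _; apply: (cone0 Yy).
by apply/mem_line; exists 1, 0; rewrite scale1r scale0r addr0.
Qed.

(** The point [p] and [c] independent points of the cone lie in [Kp], so the kernel of the Hessian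
    has dimension at least [c]. It does not contain [p], whose image is a nonzero multiple of the
    gradient; this gives independence of [q] and [p]. *)
Lemma cone_kernel (c : nat) :
  (forall i (M : 'M[K]_(i, n)), (i < c)%N -> exists2 y, Y y & ~~ (y <= M)%MS) ->
  (forall y, Y y -> (y *m B <= Kp)%MS) ->
  (2 <= d)%N /\ exists q : 'M[K]_(c, n.+1),
    [/\ row_free (col_mx q p), F.@[p 0] = 0 &
      forall a i, (dirder (row a q) F^`M(i)).@[p 0] = 0].
Proof.
move=> indep YK.
have d2 : (2 <= d)%N.
  case: (irrY) => _ [y Yy] _; have [l l0 Nl] := not_row_full (nonfree Yy).
  have [[k k2 lk]|none] := EM (exists2 k : 'I_d, (2 <= k)%N & l k 0 != 0).
    exact: ltnW (leq_ltn_trans k2 (ltn_ord k)).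
  have [] // := jet_functional_kernel hF sm l0 Nl.
  move=> k k2; apply/eqP; apply: contraT => lk; exfalso; apply: none.
  by exists k.
split=> //; have [M fM YM] := independent_points indep.
pose H := hessian F p.
have rk : (c <= \rank (kermx H))%N.
  have : (1 + c <= \rank Kp)%N.
    rewrite -(eqP (row_free_join_mx uB fM)) mxrankS // -addsmxE addsmx_sub addsmxSl /=.
    by apply/row_subP => k; rewrite row_mul; exact: YK.
  move=> /leq_trans/(_ (leq_of_leqif (mxrank_adds_leqif _ _))) h.
  by have := leq_trans h (leq_add (rank_leq_row p) (leqnn _)); rewrite leq_add2l.
pose q := rowsub (widen_ord rk) (row_base (kermx H)).
have qH : (q <= kermx H)%MS by rewrite (submx_trans (rowsub_sub _ _)) // eq_row_base.
exists q; split.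
- apply: row_free_rcons; first by rewrite row_free_widen // row_base_free.
  apply/negP => pq; have [i pi] := sm.
  have /sub_kermxP/rowP/(_ i) := submx_trans pq qH.
  case: d d2 hF => [|[|d']] // _ hF'; rewrite (mul_hessian_self _ _ hF') mxE.
  by move/eqP; rewrite mulf_eq0 pnatr_eq0 (negbTE pi).
- exact: cone_apex.
move=> a i; rewrite -mul_hessian.
have /sub_kermxP -> : (row a q <= kermx H)%MS by rewrite (submx_trans (row_sub _ _)).
by rewrite mxE.
Qed.

(** Starting from any [h0] off the zeros of [Q], the blocks of four entries are replaced one line at
    a time by coordinates of actual data, keeping [Q] nonzero; each new point is taken outside the
    span of the earlier ones. *)
Lemma cone_nonfree_dense (c : nat) : (1 < c)%N ->
  (forall i (M : 'M[K]_(i, n)), (i < c)%N -> exists2 y, Y y & ~~ (y <= M)%MS) ->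
  (exists2 y, Y y & ~~ (y *m B <= Kp)%MS) ->
  forall Q : ('I_c * 'I_4 -> K) -> K, polyfun Q -> (exists h, Q h != 0) ->
    exists (j a b : 'I_n.+1) (kk : 'I_c -> 'I_d) (p : 'rV[K]_n.+1)
      (z : 'M[K]_(c, n.+1)) (l : 'M[K]_(c, d)),
    [/\ [/\ row_free (col_mx p z), forall i, (2 <= kk i)%N & forall i, l i (kk i) != 0],
        F.@[p 0] = 0,
        forall i, restr p (row i z) F = 0,
        forall i j, \sum_k l i k * (restr p (row i z) F^`M(j))`_k = 0 &
        Q (fun t => [:: z t.1 j; z t.1 b; z t.1 a; l t.1 (kk t.1)]`_t.2) != 0].
Proof.
move=> c1 indep outK Q pQ [h0 Qh0].
have [j pj] : exists j, p 0 j != 0 by apply/rV0Pn; exact: apex_neq0.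
have [y1 Yy1 _] := indep 0%N 0 (ltnW c1).
have [b y1b] : exists b, (y1 *m B' j) 0 b != 0.
  apply/rV0Pn; apply: contra (irreducible_neq0 Yy1) => /eqP/proj_eq0 ->.
  exact: eqxx.
have [y2 Yy2 y12] := indep 1%N y1 c1.
(* A nonzero 2 by 2 minor of two distinct points of [Y]: the ratio of coordinates [a] and [b] is not
   constant on [Y]. *)
have [a y2a] : exists a, (y1 *m B' j) 0 b * (y2 *m B' j) 0 a !=
    (y2 *m B' j) 0 b * (y1 *m B' j) 0 a.
  apply: contrapT => /forallNP h; case/negP: y12.
  have e : ((y1 *m B' j) 0 b *: y2 - (y2 *m B' j) 0 b *: y1) *m B' j = 0.
    apply/rowP => a; rewrite mulmxBl -!scalemxAl.
    move: (h a) => /negP/negPn/eqP; move: (y1 *m B' j) (y2 *m B' j) => w1 w2 ha.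
    by rewrite !mxE ha subrr.
  move/proj_eq0/eqP: e; rewrite subr_eq0 => /eqP e.
  rewrite -[y2](scalerK y1b) e; do 2![apply: scalemx_sub].
  exact: submx_refl.
have ratio e1 e2 : e1 != 0 -> exists2 y, Y y &
    e1 * (y *m B' j) 0 a + e2 * (y *m B' j) 0 b != 0.
  move=> e10; have [h1|h1] := eqVneq (e1 * (y1 *m B' j) 0 a + e2 * (y1 *m B' j) 0 b) 0;
    last by exists y1.
  exists y2 => //; apply: contra_neq y2a => h2; apply: (mulfI e10).
  move: ((y1 *m B' j) 0 a) ((y1 *m B' j) 0 b) ((y2 *m B' j) 0 a) ((y2 *m B' j) 0 b)
    h1 h2.
  move=> A1 B1 A2 B2 h1 h2; apply/eqP; rewrite -subr_eq0; apply/eqP.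
  transitivity (B1 * (e1 * A2 + e2 * B2) - B2 * (e1 * A1 + e2 * B1)); first by ring.
  by rewrite h1 h2 !mulr0 subrr.
pose good (z : 'rV[K]_n.+1) (l : 'cV[K]_d) (k : 'I_d) :=
  [/\ (2 <= k)%N, l k 0 != 0 & partials_mx d F p z *m l = 0].
have [k0 _] : exists k : 'I_d, true by exists (Ordinal d0).
suff loop i : (i <= c)%N -> exists (x : 'I_c * 'I_4 -> K) (ys : nat -> 'rV[K]_n)
    (zs : nat -> 'rV[K]_n.+1) (ls : nat -> 'cV[K]_d) (ks : nat -> 'I_d),
    [/\ Q x != 0, row_free (\matrix_(e < i) ys e) &
    forall e : 'I_c, (e < i)%N ->
    [/\ Y (ys e), exists s u, s != 0 /\ zs e = s *: (ys e *m B) + u *: p,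
       good (zs e) (ls e) (ks e) &
       forall t, x (e, t) = [:: zs e 0 j; zs e 0 b; zs e 0 a; ls e (ks e) 0]`_t]].
  have [x [ys [zs [ls [ks [Qx fM hx]]]]]] := loop c (leqnn c).
  exists j, a, b, (fun i => ks i), p, (\matrix_(i < c) zs i), (\matrix_(i < c) (ls
    i)^T).
  have rz i : row i (\matrix_(i < c) zs i) = zs i by rewrite rowK.
  split.
  - split; last 1 first.
    + by move=> i; have [_ _ [_ lk _] _] := hx i (ltn_ord i); rewrite !mxE.
    + rewrite /row_free eqn_leq rank_leq_row /= -[X in (X <= _)%N](eqP
      (row_free_join_mx uB fM)).
      apply: mxrankS; rewrite -!addsmxE addsmx_sub addsmxSl /=; apply/row_subP => i.
      have [_ [s [u [s0 zE]]] _ _] := hx i (ltn_ord i).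
      rewrite row_mul rowK.
      have -> : ys i *m B = s^-1 *: (zs i - u *: p) by rewrite zE addrK scalerK.
      apply: scalemx_sub; apply: addmx_sub.
        by rewrite -(rz i) (submx_trans (row_sub _ _)) // addsmxSr.
      by rewrite eqmx_opp; apply: scalemx_sub; exact: addsmxSl.
    by move=> i; have [_ _ [k2 _ _] _] := hx i (ltn_ord i).
  - exact: cone_apex.
  - move=> i; rewrite rz; have [Yi [s [u [s0 zE]]] _ _] := hx i (ltn_ord i).
    apply: poly_eq_nonzero => t _; rewrite horner_restr horner0; apply: (cone0 Yi).
    apply/mem_line; exists (1 + t * u), (t * s).
    by rewrite zE scalerDr !scalerA scalerDl scale1r -addrA [X in _ = _ + X]addrC.
  - move=> i e; rewrite rz; have [_ _ [_ _ Ne] _] := hx i (ltn_ord i).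
    have /colP/(_ e) := Ne; rewrite !mxE => {}Ne; rewrite -[RHS]Ne;
      apply: eq_bigr => k _.
    by rewrite !mxE mulrC.
  rewrite (_ : (fun t => _) = x) //; apply/funext => -[i t] /=.
  have [_ _ _ ->] := hx i (ltn_ord i); congr (nth _ _ _).
  by rewrite !mxE.
elim: i => [|i IH] ic.
  exists h0, (fun=> 0), (fun=> 0), (fun=> 0), (fun=> k0); split=> //.
  by rewrite /row_free flatmx0 mxrank0.
have [x [ys [zs [ls [ks [Qx fM hx]]]]]] := IH (ltnW ic).
have tI : injective (fun t : 'I_4 => (Ordinal ic, t)) by move=> t t' [].
have yb : exists2 y, Y y & (y *m B' j) 0 b != 0 by exists y1.
have [x' [y [z [l [k [[Yy yM zE] gk Qx' xt xs]]]]]] :=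
  cone_point tI pQ Qx pj (indep _ (\matrix_(e < i) ys e) ic) outK yb ratio.
have eM : \matrix_(e < i) update ys i y e = \matrix_(e < i) ys e.
  by apply/matrixP => e e'; rewrite !mxE /update (ltn_eqF (ltn_ord e)).
exists x', (update ys i y), (update zs i z), (update ls i l), (update ks i k);
  split=> //.
  apply: row_free_next; rewrite eM // /update eqxx.
  exact: yM.
move=> e; rewrite ltnS leq_eqVlt /update; case: eqP => [ei _|/eqP ne /= lt].
  split=> // t; rewrite -xt; congr (x' (_, t)); exact/val_inj.
have [Ye ze ge xe] := hx e lt; split=> // t; rewrite xs //.
by move=> t'; rewrite xpair_eqE -val_eqE /= (negbTE ne).
Qed.

End ConeLines.

(** Numerical hypotheses become part of the property, so that a union over all [k] or [c] can be
    formed; where they fail the property is empty. *)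
Lemma thin_and (K : numFieldType) (V : vectType K) (A : Prop) (P : V -> Prop) :
  (A -> thin P) -> thin (fun v => A /\ P v).
Proof.
move=> h; have [/h|nA] := EM A; first by apply: thin_sub => v [].
exists (fun=> 1); first by exists (fun=> 1) => //; exact: polyfun_cst.
by split=> [|v []//]; exists 0; exact: oner_neq0.
Qed.

(** Otherwise the rows of [M] would span a space containing [Y] of dimension smaller than the
    minimal one. *)
Lemma span_independent (K : fieldType) (n m i : nat) (Y : set 'rV[K]_n)
    (W : {vspace 'rV[K]_n}) (M : 'M[K]_(i, n)) :
  is_linear_span Y W -> \dim W = m -> (i < m)%N -> exists2 y, Y y & ~~ (y <= M)%MS.
Proof.
move=> [_ minW] dW im; apply: contrapT => none.
pose W' := <<[tuple row k M | k < i]>>%VS.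
have : (W <= W')%VS.
  apply: minW => y Yy; have /submxP[c ->] : (y <= M)%MS.
    by apply: contraT => yM; exfalso; apply: none; exists y.
  rewrite mulmx_sum_row memv_suml // => k _; apply: memvZ; apply: memv_span.
  by apply/tnthP; exists k; rewrite tnth_mktuple.
move=> /dimvS; rewrite dW => h.
have := leq_trans im (leq_trans h (dim_span _)).
by rewrite size_tuple ltnn.
Qed.

Theorem proposition6p5 (R : realType) (n d : nat) (hd : (0 < d)%N) :
  for_general (proj_space (dhomog n.+1 R[i] d))
    (fun F : dhomog n.+1 R[i] d =>
      forall (p : 'rV[R[i]]_n.+1) (B : 'M[R[i]]_(n, n.+1)),
        (col_mx p B : 'M[R[i]]_n.+1) \in unitmx ->
      forall Y : set 'rV[R[i]]_n,
        proj_curve Y ->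
        cone_over p B Y `<=` hypersurface F ->
      forall m : nat,
        linear_span_dim Y m ->
        (n%:R - 2%:R) / 2%:R < m%:R :> rat ->
        for_general Y (fun y => free_line F (join_line p B y))).
Proof.
(* The union runs over all possible dimensions of the span, since the exceptional set cannot depend
   on [Y]. *)
have thin_bad := thin_or (@thin_singular R[i] n d hd)
  (thin_or (thin_ex (fun k : 'I_n.+1 => thin_and (fun h : (2 <= d)%N =>
      thin_and (fun lt : (2 * n < 2 + k * k.+1)%N =>
        @thin_hessian R[i] n d k h (ltn_ord k) lt))))
    (thin_ex (fun c : 'I_n.+1 => thin_and (fun lt : (n < 2 * c)%N =>
      @thin_nonfree_lines R[i] n d c lt)))).
apply: (for_general_thin _ thin_bad).
  exists (DHomog (dualformX_homog (1%:M : 'M[R[i]]_n.+1) ord0 d)).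
  apply/eqP => /(congr1 (fun F : dhomog n.+1 R[i] d => F.@[row ord0 1%:M 0])) /=.
  rewrite rmorphXn /= meval_dualform ?unitmx1 // eqxx expr1n meval0 => /eqP.
  by rewrite oner_eq0.
move=> F F0 good p B uB Y [irrY _] cone m [W spanW dW] nm.
have hF : (F : {mpoly R[i][n.+1]}) \is d.-homog by exact: dhomog_is_dhomog.
have [[y [Yy full]]|none] := EM (exists y, Y y /\ row_full (partials_mx d F p (y *m
  B))).
  by apply: (general_line_free hd uB _ cone Yy full); case: irrY.
exfalso.
have nonfree y : Y y -> ~~ row_full (partials_mx d F p (y *m B)).
  by move=> Yy; apply/negP => full; apply: none; exists y.
(* As [m] is a projective dimension, [Y] contains [m.+1] independent points, and [(n - 2) / 2 < m]
   reads [n < 2 (m + 1)]. *)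
have nm2 : (n < 2 * m.+1)%N.
  move: nm; rewrite ltr_pdivrMr // ltrBlDr -!natrM -natrD ltr_nat.
  lia.
have mn : (m.+1 <= n)%N.
  by rewrite -dW (leq_trans (dimvS (subvf W))) // dimvf /dim /= mul1n.
have indep i (M : 'M[R[i]]_(i, n)) : (i < m.+1)%N -> exists2 y, Y y & ~~ (y <= M)%MS.
  exact: span_independent spanW dW.
have p0 := apex_neq0 uB.
have sm : exists i, (F^`M(i)).@[p 0] != 0.
  apply: contrapT => /forallNP h; apply: good; left; exists p => // i.
  by apply/eqP; apply: contraT => hi; case: (h i).
have cone0 y : Y y -> forall q, q \in (<[p]> + <[y *m B]>)%VS -> F.@[q 0] = 0.
  move=> Yy q qL; have [->|q0] := eqVneq q 0.
    by rewrite -(scale0r 0) (homog_mevalZ _ _ hF) expr0n gtn_eqF ?mul0r.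
  by have [] : hypersurface F q by apply: cone; split=> //; exists y.
(* Two distinct points of [Y] are required. If [m = 0] then [n = 1], so [p] and one point of the
   cone span the whole of [K ^ 2] and [F] would be zero. *)
have m1 : (1 < m.+1)%N.
  rewrite ltnS lt0n; apply/eqP => m0; have n1 : n = 1%N by lia.
  move: n1 => ?; subst n.
  case: (irrY) => _ [y Yy] _; have fy := row_free_join uB (irreducible_neq0 irrY Yy).
  have [v hv] : exists v, F.@[v] != 0 by apply: meval_neq0.
  case/eqP: hv; have -> : F.@[v] = F.@[(\row_i v i) 0].
    by apply: meval_eq => i; rewrite mxE.
  apply: (cone0 _ Yy); set q := \row_i v i.
  have uq : (col_mx p (y *m B) : 'M_2) \in unitmx by rewrite -row_free_unit.
  rewrite -[q](mulmxKV uq).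
  apply/mem_line; set c := q *m _.
  have := mul_row_col (lsubmx (c : 'M_(1, 1 + 1))) (rsubmx (c : 'M_(1, 1 + 1))) p
    (y *m B).
  rewrite hsubmxK => ->.
  rewrite (mx11_scalar (lsubmx _)) (mx11_scalar (rsubmx _)) !mul_scalar_mx.
  by do 2!eexists.
have mo : (m.+1 < n.+1)%N by rewrite ltnS.
pose Kp := (p + kermx (hessian F p))%MS.
have [outK|inK] := EM (exists2 y, Y y & ~~ (y *m B <= Kp)%MS).
  apply: good; right; right; exists (Ordinal mo); split=> //.
  exact: (cone_nonfree_dense hd hF uB irrY sm nonfree cone0 m1 indep outK).
have YK y : Y y -> (y *m B <= Kp)%MS.
  by move=> Yy; apply: contraT => yK; exfalso; apply: inK; exists y.
have [d2 [q hq]] := cone_kernel hF uB irrY sm nonfree cone0 indep YK.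
apply: good; right; left; exists (Ordinal mo); split=> //; split; last by exists p, q.
(* With [k = m + 1], [n < 2 k] gives [2 n <= 4 k - 2], and [k ^ 2 - 3 k + 4] is always positive. *)
by rewrite /=; nia.
Qed.
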